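(* Consider parameter spaces $\mathcal{P}_n'(\theta,p,q,k,\beta;\delta,\alpha)$ with $\alpha,\beta\ge1$ constants, and assume that as $n\to\infty$, $\delta=o(1)$, $1<p/q=O(1)$ and $\|\theta\|_\infty=o(n/k)$. Let $\tau=C_1(np\|\theta\|_\infty^2+1)$ for some sufficiently large constant $C_1>0$ in Algorithm 1, and let $\hat z$ be the output of Algorithm 1 with slack $\epsilon$. Then there exist constants $C',C>0$ such that, for any generative model in $\mathcal{P}_n'(\theta,p,q,k,\beta;\delta,\alpha)$, with probability at least $1-n^{-(1+C')}$, $$\min_{\pi\in\Pi_k}\sum_{\{i:\hat z(i)\ne\pi(z(i))\}}\theta_i\le C\,\frac{(1+\epsilon)k^{5/2}\sqrt{n\|\theta\|_\infty^2p+1}}{p-q}.$$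
   Context: Notation: $[k]=\{1,\dots,k\}$; $k\ge2$; $\Pi_k$ is the set of permutations of $[k]$; $\|\theta\|_\infty=\max_i|\theta_i|$; $\|v\|_1=\sum_i|v_i|$; $\|\cdot\|_{\rm F}$ is the Frobenius norm. Asymptotics are as $n\to\infty$, and $\theta,p,q,k,\delta$ may depend on $n$. Parameter space. Given $\theta\in\mathbb{R}_+^n$, for $z\in[k]^n$ let $n_u=n_u(z)=|\{i\in[n]:z(i)=u\}|$. $\mathcal{P}_n(\theta,p,q,k,\beta;\delta)$ is the set of $P\in[0,1]^{n\times n}$ for which there exist $z\in[k]^n$ and $B=B^T\in\mathbb{R}^{k\times k}$ such that: $P_{ii}=0$, $P_{ij}=\theta_i\theta_jB_{z(i)z(j)}$ for $i\ne j$; $\frac1{n_u}\sum_{i:z(i)=u}\theta_i\in[1-\delta,1+\delta]$ for all $u$; $\max_{u\ne v}B_{uv}\le q<p\le\min_uB_{uu}$; $\frac n{\beta k}-1\le n_u\le\frac{\beta n}k+1$ for all $u$. $\mathcal{P}_n'(\theta,p,q,k,\beta;\delta,\alpha)$ is the subset where in addition $\max_{u}B_{uu}\le\alpha p$; $\alpha\ge1$ and $\beta\ge1$ are constants not depending on $n$. Model: for such $P$ with true label vector $z$, one observes symmetric $A\in\{0,1\}^{n\times n}$ with zero diagonal and independent $A_{ij}=A_{ji}\sim\mathrm{Bern}(P_{ij})$, $i<j$. Algorithm 1 (input: adjacency matrix $A\in\{0,1\}^{n\times n}$, $k$, $\tau$, slack $\epsilon$): (1) let $T_\tau(A)$ be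 obtained from $A$ by replacing by zeros the $i$th row and column for every $i$ whose row sum in $A$ is larger than $\tau$; (2) let $\hat P$ be a minimizer of $\|T_\tau(A)-P\|_{\rm F}^2$ over matrices $P$ with $\mathrm{rank}(P)\le k$; (3) let $\hat P_i$ be the $i$th row of $\hat P$, $S_0=\{i:\|\hat P_i\|_1=0\}$, set $\hat z(i)=0$ for $i\in S_0$ and $\tilde P_i=\hat P_i/\|\hat P_i\|_1$ for $i\notin S_0$; (4) find labels $\{\hat z(i)\}_{i\in S_0^c}$ in $[k]$ with $$\sum_{u=1}^k\min_{v_u\in\mathbb{R}^n}\sum_{i\in S_0^c:\hat z(i)=u}\|\hat P_i\|_1\|\tilde P_i-v_u\|_1\le(1+\epsilon)\min_{z'\in[k]^n}\sum_{u=1}^k\min_{v_u\in\mathbb{R}^n}\sum_{i\in S_0^c:z'(i)=u}\|\hat P_i\|_1\|\tilde P_i-v_u\|_1.$$ Output $\hat z\in(\{0\}\cup[k])^n$. *)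

(* Defs.v *)
From HB Require Import structures.
From mathcomp Require Import all_boot all_order all_algebra all_fingroup.
From mathcomp Require Import all_classical all_reals all_analysis.
Set Implicit Arguments.
Unset Strict Implicit.
Unset Printing Implicit Defensive.
Import Order.TTheory GRing.Theory Num.Theory.
Import numFieldNormedType.Exports.
Local Open Scope classical_set_scope.
Local Open Scope ring_scope.

(* Minimum of a real function, as the infimum of its range.  It is applied
   only where the minimum is attained: on nonempty finite types, and to sums
   of weighted l1 distances to a point of R^n. *)
Definition minval (R : realType) (T : Type) (f : T -> R) : R := inf (range f).

Definition l1norm (R : realType) (n : nat) (v : 'rV[R]_n) : R :=
  \sum_(j < n) `|v 0 j|.

Definition frob_norm (R : realType) (m n : nat) (X : 'M[R]_(m, n)) : R :=
  Num.sqrt (\sum_(i < m) \sum_(j < n) X i j ^+ 2).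

Definition csize (n k : nat) (z : 'I_n -> 'I_k) (u : 'I_k) : nat :=
  #|[pred i | z i == u]|.

(* z and B witness the membership of P in the parameter space
   P_n(theta, p, q, k, beta; delta), with [k] encoded as 'I_k.  Since
   x / 0 = 0, the condition on the averages excludes empty communities as soon
   as delta < 1. *)
Definition dcbm_witness (R : realType) (n k : nat) (theta : 'rV[R]_n)
    (p q beta delta : R) (P : 'M[R]_n) (z : 'I_n -> 'I_k) (B : 'M[R]_k) : Prop :=
  (forall i j, 0 <= P i j <= 1) /\
  B^T = B /\
  (forall i, P i i = 0) /\
  (forall i j, i != j -> P i j = theta 0 i * theta 0 j * B (z i) (z j)) /\
  (forall u, 1 - delta <=
     (\sum_(i < n | z i == u) theta 0 i) / (csize z u)%:R <= 1 + delta) /\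
  (forall u v, u != v -> B u v <= q) /\
  q < p /\
  (forall u, p <= B u u) /\
  (forall u, n%:R / (beta * k%:R) - 1 <= (csize z u)%:R
               <= beta * n%:R / k%:R + 1).

(* P belongs to P_n'(theta, p, q, k, beta; delta, alpha) with label vector z. *)
Definition dcbm' (R : realType) (n k : nat) (theta : 'rV[R]_n)
    (p q beta delta alpha : R) (P : 'M[R]_n) (z : 'I_n -> 'I_k) : Prop :=
  exists B : 'M[R]_k, dcbm_witness theta p q beta delta P z B /\
    (forall u, B u u <= alpha * p).

(* The events {X e \in S e}, e in J, satisfy the product rule for every
   subfamily J of D and every choice of S. *)
Definition mutually_independent d (T : measurableType d) (R : realType)
    (Pr : probability T R) (I : finType) (D : {set I})
    (X : I -> {RV Pr >-> bool}) : Prop :=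
  forall (J : {set I}) (S : I -> set bool), J \subset D ->
    Pr (\bigcap_(e in [set` J]) (X e @^-1` S e)) =
    (\prod_(e in J) Pr (X e @^-1` S e))%E.

Definition dcbm_sample d (T : measurableType d) (R : realType)
    (Pr : probability T R) (n : nat) (P : 'M[R]_n)
    (A : 'I_n * 'I_n -> {RV Pr >-> bool}) : Prop :=
  [/\ forall i w, A (i, i) w = false,
      forall i j w, A (i, j) w = A (j, i) w,
      forall i j : 'I_n, (i < j)%N ->
        distribution Pr (A (i, j)) =1 bernoulli_prob (P i j) &
      mutually_independent [set e : 'I_n * 'I_n | (e.1 < e.2)%N]%SET A].

Definition adjacency d (T : measurableType d) (R : realType)
    (Pr : probability T R) (n : nat) (A : 'I_n * 'I_n -> {RV Pr >-> bool})
    (w : T) : 'M[R]_n :=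
  \matrix_(i, j) (A (i, j) w)%:R.

Definition trim (R : realType) (n : nat) (tau : R) (A : 'M[R]_n) : 'M[R]_n :=
  \matrix_(i, j)
    (if (tau < \sum_l A i l) || (tau < \sum_l A j l) then 0 else A i j).

Definition low_rank_minimizer (R : realType) (n : nat) (X : 'M[R]_n) (k : nat)
    (Phat : 'M[R]_n) : Prop :=
  (\rank Phat <= k)%N /\
  forall Q : 'M[R]_n, (\rank Q <= k)%N ->
    frob_norm (X - Phat) ^+ 2 <= frob_norm (X - Q) ^+ 2.

Definition zero_rows (R : realType) (n : nat) (Phat : 'M[R]_n) : {set 'I_n} :=
  [set i | l1norm (row i Phat) == 0]%SET.

Definition normalized_row (R : realType) (n : nat) (Phat : 'M[R]_n) (i : 'I_n) :
    'rV[R]_n :=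
  (l1norm (row i Phat))^-1 *: row i Phat.

Definition kmedian_cost (R : realType) (n k : nat) (Phat : 'M[R]_n)
    (zh : 'I_n -> option 'I_k) : R :=
  \sum_(u < k) minval (fun v : 'rV[R]_n =>
    \sum_(i < n | (i \notin zero_rows Phat) && (zh i == Some u))
      l1norm (row i Phat) * l1norm (normalized_row Phat i - v)).

(* Labels in {0} u [k] are encoded as option 'I_k, None standing for 0.
   zh is a possible output of the algorithm on (A, k, tau, eps); neither the
   low-rank approximation nor the approximate k-medians solution is unique. *)
Definition alg1_output (R : realType) (n k : nat) (A : 'M[R]_n) (tau eps : R)
    (zh : 'I_n -> option 'I_k) : Prop :=
  exists Phat : 'M[R]_n,
    [/\ low_rank_minimizer (trim tau A) k Phat,
        forall i, (zh i == None) = (i \in zero_rows Phat) &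
        kmedian_cost Phat zh <= (1 + eps) *
          minval (fun z' : {ffun 'I_n -> 'I_k} =>
                    kmedian_cost Phat (fun i => Some (z' i)))].

Definition misclustering (R : realType) (n k : nat) (theta : 'rV[R]_n)
    (z : 'I_n -> 'I_k) (zh : 'I_n -> option 'I_k) : R :=
  minval (fun s : {perm 'I_k} =>
    \sum_(i < n | zh i != Some (s (z i))) theta 0 i).

(* Main.v *)
Require Import Defs.
From HB Require Import structures.
From mathcomp Require Import all_boot all_order all_algebra all_fingroup.
From mathcomp Require Import all_classical all_reals all_analysis.
From mathcomp Require Import lra ring.
Set Implicit Arguments.
Unset Strict Implicit.
Unset Printing Implicit Defensive.
Import Order.TTheory GRing.Theory Num.Theory.
Import numFieldNormedType.Exports.
Local Open Scope classical_set_scope.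
Local Open Scope ring_scope.

(** Write [sd ^+ 2 = n p |theta|^2 + 1], and let [Q] be the matrix of rank at most
    [k] with entries [theta_i theta_j B (z i) (z j)], diagonal included.  Off the diagonal
    its entries are the edge probabilities, and they are at most [alpha sd^2 / n].

    Spectral step.  With probability at least [1 - n ^- 2] the trimmed matrix [T]
    satisfies [x^T (T - Q) y <= C sd] for all unit vectors [x] and [y]
    ([trimmed_spectral_bound]); this is the method of Feige and Ofek.  The graph is
    written as [U + U^T], with the entries of the strictly upper triangular [U]
    independent.  Unit vectors are rounded to integer vectors over [sqrt n]
    ([lattice_rounding]), of which only [expR (O(n))] are needed ([card_ball]).  Pairs
    [(i, j)] with [|v_i w_j| <= sd] are light: their centred sum has bounded
    exponents, and Chernoff's bound survives the union over all [v] and [w]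
    ([light_fail]).  For the heavy pairs two properties that do not mention [v] and
    [w] suffice: untrimmed degrees are [O(sd^2)], and no two vertex sets are joined by
    many more edges than expected ([disc_fail]).  A dyadic decomposition of [v] and
    [w] deduces the heavy bound from them ([heavy_bound]).  The same discrepancy
    property shows that only [O(n / sd^2)] vertices are trimmed
    ([card_high_degree]); this is where the constant in the threshold has to be large.

    From the spectral norm to rows.  [Phat] is at least as close to [T] as [Q] is, and
    [Phat - Q] has rank at most [2 k], so [|Phat - Q|_F^2 = O(k sd^2)]
    ([low_rank_denoising]).  By the Cauchy-Schwarz inequality the l1 distances between
    the rows of [Phat] and of [Q] add up to [F = O(n sqrt k sd)] ([l1_error]).

    From rows to labels.  The normalised rows of [Q] take [k] values, at mutual l1
    distance at least of order [Delta = (p - q) / (k p)] ([centers_separated]), and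
    row [i] of [Q] has l1 norm at least of order [theta_i p n / k]
    ([row_weight_bounds]).  In the k-medians objective the weights cancel the
    normalisation, so the true centres cost [O(F)] and the total row mass of the
    vertices whose fitted centre is off by more than [Delta / 2] is
    [O((1 + eps) F / Delta)].  Division by [p n / k] turns this into the claimed
    bound, of order [(1 + eps) k^2 sqrt k sd / (p - q)], for the [theta] mass of these
    vertices.  On all other vertices, vertices of different communities receive
    different labels, and a counting argument produces the permutation
    ([label_matching], [kmedian_recovery]).

    All of this is deterministic once the light and discrepancy properties hold, and
    these depend on the graph only; so every measurable choice among the possible
    outputs of the algorithm satisfies the bound on the same event. *)


(** * Independent Bernoulli arrays *)

(** The law of an array of independent Bernoulli variables is kept as an explicit
    weight on the finite set of configurations, so that every probability estimate
    below is an estimate on finite sums. *)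
Definition bern_weight (R : realType) (I : finType) (pr : I -> R)
    (f : {ffun I -> bool}) : R :=
  \prod_e (if f e then pr e else 1 - pr e).

Definition bern_prob (R : realType) (I : finType) (pr : I -> R)
    (Q : pred {ffun I -> bool}) : R :=
  \sum_(f | Q f) bern_weight pr f.

Lemma bern_weight_ge0 (R : realType) (I : finType) (pr : I -> R) f :
  (forall e, 0 <= pr e <= 1) -> 0 <= bern_weight pr f.
Proof.
move=> pr01; apply: prodr_ge0 => e _; case/andP: (pr01 e) => p0 p1.
by case: ifP => // _; rewrite subr_ge0.
Qed.

Lemma bern_prob_le (R : realType) (I : finType) (pr : I -> R) (Q Q' : pred _) :
  (forall e, 0 <= pr e <= 1) -> (forall f, Q f -> Q' f) ->
  bern_prob pr Q <= bern_prob pr Q'.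
Proof.
move=> pr01 QQ'; rewrite /bern_prob big_mkcond [leRHS]big_mkcond.
apply: ler_sum => f _; case: ifP => [/QQ' -> //|_].
by case: ifP => // _; apply: bern_weight_ge0.
Qed.

Lemma bern_prob_or (R : realType) (I : finType) (pr : I -> R) (Q Q' : pred _) :
  (forall e, 0 <= pr e <= 1) ->
  bern_prob pr (fun f => Q f || Q' f) <= bern_prob pr Q + bern_prob pr Q'.
Proof.
move=> pr01; rewrite /bern_prob big_mkcond [leRHS]addrC.
rewrite [X in X + _]big_mkcond [X in _ + X]big_mkcond -big_split /=.
apply: ler_sum => f _; have := bern_weight_ge0 f pr01.
by case: (Q f); case: (Q' f) => /= w0; rewrite ?addr0 ?add0r // lerDl.
Qed.

Lemma bern_prob_exists (R : realType) (I K : finType) (pr : I -> R)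
    (S : pred K) (Q : K -> pred {ffun I -> bool}) :
  (forall e, 0 <= pr e <= 1) ->
  bern_prob pr (fun f => [exists x, S x && Q x f])
    <= \sum_(x | S x) bern_prob pr (Q x).
Proof.
move=> pr01; rewrite /bern_prob.
have -> : \sum_(x | S x) \sum_(f | Q x f) bern_weight pr f =
    \sum_f \sum_(x | S x && Q x f) bern_weight pr f.
  rewrite (eq_bigr (fun x => \sum_f if Q x f then bern_weight pr f else 0));
    last by move=> x _; rewrite big_mkcond.
  by rewrite exchange_big; apply: eq_bigr => f _; rewrite -big_mkcondr.
rewrite big_mkcond; apply: ler_sum => f _; have w0 := bern_weight_ge0 f pr01.
case: ifP => [/existsP[x xP]|_]; last exact: sumr_ge0.
by rewrite (bigD1 x) //= lerDl; apply: sumr_ge0.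
Qed.

(** Exponential Markov inequality: the moment generating function factorises over
    the array, and each factor [1 + pr e (expR (c e) - 1)] is at most its
    exponential. *)
Lemma chernoff (R : realType) (I : finType) (pr c : I -> R) (s : R) :
  (forall e, 0 <= pr e <= 1) ->
  bern_prob pr (fun f => s <= \sum_e c e * (f e)%:R)
    <= expR (\sum_e pr e * (expR (c e) - 1) - s).
Proof.
move=> pr01.
have -> : expR (\sum_e pr e * (expR (c e) - 1) - s) =
    expR (- s) * \prod_e expR (pr e * (expR (c e) - 1)).
  by rewrite addrC expRD expR_sum.
apply: (@le_trans _ _ (\sum_(f : {ffun I -> bool}) expR (\sum_e c e * (f e)%:R - s) * bern_weight pr f)).
  rewrite /bern_prob big_mkcond; apply: ler_sum => f _.
  have w0 := bern_weight_ge0 f pr01.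
  case: ifP => [sle|_]; last by rewrite mulr_ge0 ?expR_ge0.
  by rewrite ler_peMl // -[leLHS]expR0 ler_expR subr_ge0.
rewrite (eq_bigr (fun f : {ffun I -> bool} => expR (- s) *
    \prod_e (expR (c e * (f e)%:R) * (if f e then pr e else 1 - pr e)))); last first.
  by move=> f _; rewrite addrC expRD expR_sum -mulrA -big_split.
rewrite -big_distrr /= ler_wpM2l ?expR_ge0 //.
pose F e (b : bool) := expR (c e * b%:R) * (if b then pr e else 1 - pr e).
have -> : \sum_(f : {ffun I -> bool})
    \prod_e (expR (c e * (f e)%:R) * (if f e then pr e else 1 - pr e)) =
    \prod_e \sum_b F e b by rewrite bigA_distr_bigA.
apply: ler_prod => e _; rewrite !big_bool /F /= !mulr1 mulr0 expR0 mul1r.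
case/andP: (pr01 e) => p0 p1; apply/andP; split.
  by rewrite addr_ge0 ?mulr_ge0 ?expR_ge0 ?subr_ge0.
apply: le_trans (expR_ge1Dx _); rewrite le_eqVlt; apply/orP; left; apply/eqP; ring.
Qed.

(** The bridge from the abstract probability space to configurations.  Coordinates
    outside [D] are set to [false] and given parameter 0, which makes the array
    fully independent over [I] although independence is only assumed over [D]. *)
Lemma bern_prob_law d (T : measurableType d) (R : realType)
    (Pr : probability T R) (I : finType) (D : {set I})
    (X : I -> {RV Pr >-> bool}) (pr : I -> R) (Q : pred {ffun I -> bool}) :
  (forall e, 0 <= pr e <= 1) ->
  (forall e, e \in D -> distribution Pr (X e) =1 bernoulli_prob (pr e)) ->
  (forall e, e \notin D -> pr e = 0) ->
  mutually_independent D X ->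
  measurable [set w | Q [ffun e => (e \in D) && X e w]] /\
  Pr [set w | Q [ffun e => (e \in D) && X e w]] = (bern_prob pr Q)%:E.
Proof.
move=> pr01 lawX prD indX.
pose conf w : {ffun I -> bool} := [ffun e => (e \in D) && X e w].
have mX e (S : set bool) : measurable (X e @^-1` S).
  by rewrite -[X in measurable X]setTI; apply: measurable_funP.
have PX e (b : bool) : e \in D ->
    Pr (X e @^-1` [set b]) = (if b then pr e else 1 - pr e)%:E.
  move=> eD; have -> : Pr (X e @^-1` [set b]) = bernoulli_prob (pr e) [set b].
    by rewrite -lawX.
  rewrite bernoulli_probE // !diracE.
  case: b; rewrite ?(mem_set (erefl : [set true] true))
     ?(mem_set (erefl : [set false] false)) memNset //.
    by rewrite mule1 mule0 adde0.
  by rewrite mule1 mule0 add0e.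
have confE f : [set w | conf w = f] =
    if [forall e, (e \notin D) ==> ~~ f e] then
      \bigcap_(e in [set` D]) (X e @^-1` [set f e]) else set0.
  case: ifPn => [/forallP fD|].
    apply/seteqP; split => w /=.
      by move=> <- e /= eD; rewrite ffunE eD.
    move=> H; apply/ffunP => e; rewrite ffunE; have [eD|eD] /= := boolP (e \in D).
      exact: (H e).
    by apply/esym/negbTE; apply: (implyP (fD e)).
  rewrite negb_forall => /existsP[e]; rewrite negb_imply negbK => /andP[eD fe].
  apply/seteqP; split => w //= cf; move: fe; rewrite -cf ffunE.
  by rewrite (negbTE eD).
have mconf f : measurable [set w | conf w = f].
  rewrite confE; case: ifP => // _.
  apply: fin_bigcap_measurable => // e _; exact: mX.
have Pconf f : Pr [set w | conf w = f] = (bern_weight pr f)%:E.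
  rewrite confE /bern_weight; case: ifPn => [/forallP fD|].
    rewrite (indX _ (fun e => [set f e])) //.
    transitivity ((\prod_(e in D) (if f e then pr e else 1 - pr e))%:E).
      rewrite -prodEFin; apply: eq_bigr => e; exact: PX.
    congr (_%:E); rewrite big_mkcond /=; apply: eq_bigr => e _.
    case: ifPn => // eD; have := implyP (fD e) eD; case: (f e) => // _.
    by rewrite prD // subr0.
  rewrite negb_forall => /existsP[e]; rewrite negb_imply negbK => /andP[eD fe].
  by rewrite measure0 (bigD1 e) //= fe prD // mul0r.
have -> : [set w | Q (conf w)] =
    \bigcup_(f in [set` Q]) [set w | conf w = f].
  apply/seteqP; split => w /=.
    by move=> Qw; exists (conf w).
  by case=> f /= + cf; rewrite -cf.
split; first by apply: fin_bigcup_measurable => // f _; exact: mconf.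
rewrite measure_fin_bigcup //; last by move=> f g _ _ [w [/= <- <-]].
rewrite -[RHS]sumEFin.
rewrite -(@bigfs _ _ _ _ (index_enum _) Q) ?index_enum_uniq //; last first.
  by move=> f _; rewrite mem_index_enum.
by apply: eq_bigr => f _; apply: Pconf.
Qed.

(** * Light pairs *)

(** For [c <= 0] this follows from [expR c <= 1 / (1 - c)]; for [c > 0] from
    [expR c <= 1 / (1 - c / 2) ^+ 2].  Both come from [1 + x <= expR x]. *)
Lemma expR_le_quadratic (R : realType) (c : R) :
  `|c| <= 1 -> expR c <= 1 + c + 2 * c ^+ 2.
Proof.
rewrite ler_norml => /andP[cge cle].
have [c0|c0] := leP c 0.
  have h : 1 - c <= expR (- c) by exact: expR_ge1Dx.
  rewrite -[c in expR c]opprK expRN.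
  apply: (@le_trans _ _ (1 - c)^-1).
    by rewrite lef_pV2 ?posrE ?expR_gt0 //; lra.
  rewrite -[leLHS]div1r ler_pdivrMr; last by lra.
  have -> : (1 + c + 2 * c ^+ 2) * (1 - c) = 1 + c ^+ 2 * (1 - 2 * c) by ring.
  by rewrite lerDl mulr_ge0 ?sqr_ge0 //; lra.
have h : 1 - c / 2 <= expR (- (c / 2)) by exact: expR_ge1Dx.
have cE : expR c = (expR (- (c / 2)))^-1 ^+ 2.
  by rewrite -expRN opprK expr2 -expRD; congr expR; lra.
rewrite cE exprVn; apply: (@le_trans _ _ ((1 - c / 2) ^+ 2)^-1).
  rewrite lef_pV2 ?posrE ?exprn_gt0 ?expR_gt0 //; last lra.
  by apply: lerXn2r; rewrite ?nnegrE ?expR_ge0 //; lra.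
rewrite -[leLHS]mul1r ler_pdivrMr ?exprn_gt0 //; last lra.
have -> : (1 + c + 2 * c ^+ 2) * (1 - c / 2) ^+ 2 =
   1 + c ^+ 2 * ((1 - c) * (5 / 4 - c / 2)) by field.
by rewrite lerDl mulr_ge0 ?sqr_ge0 // mulr_ge0; lra.
Qed.

(** Integer vectors, stored as a sign and a magnitude.  The bound [2 n] on the
    magnitudes is no restriction inside the ball below, where squares are at most
    [4 n]; it makes the set of vectors finite. *)
Definition lattice_vec (n : nat) := {ffun 'I_n -> bool * 'I_(2 * n).+1}.

Definition mag n (v : lattice_vec n) (i : 'I_n) : nat := (v i).2.

Definition lat (R : realType) n (v : lattice_vec n) (i : 'I_n) : R :=
  (-1) ^+ (v i).1 * (mag v i)%:R.

(** After division by [sqrt n] these are the lattice points of the Euclidean ball of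
    radius 2. *)
Definition in_ball n (v : lattice_vec n) : bool :=
  (\sum_i mag v i ^ 2 <= 4 * n)%N.

Lemma normr_lat (R : realType) n (v : lattice_vec n) i :
  `|lat R v i| = (mag v i)%:R.
Proof. by rewrite /lat normrM normrX normrN1 expr1n mul1r ger0_norm. Qed.

Lemma sqr_lat (R : realType) n (v : lattice_vec n) i :
  lat R v i ^+ 2 = (mag v i)%:R ^+ 2.
Proof. by rewrite -[LHS]ger0_norm ?sqr_ge0 // normrX normr_lat. Qed.

Lemma sum_sqr_lat (R : realType) n (v : lattice_vec n) :
  in_ball v -> \sum_i lat R v i ^+ 2 <= 4 * n%:R.
Proof.
rewrite /in_ball -(ler_nat R) natr_sum natrM; apply: le_trans.
by apply: ler_sum => i _; rewrite sqr_lat natrX.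
Qed.

Lemma sum_pow2V (R : realType) (m : nat) : \sum_(k < m) (2^-1 : R) ^+ k <= 2.
Proof.
suff -> : \sum_(k < m) (2^-1 : R) ^+ k = 2 - 2 * 2^-1 ^+ m.
  by rewrite gerBl mulr_ge0 ?exprn_ge0 ?invr_ge0.
elim: m => [|m IH]; first by rewrite big_ord0 expr0; lra.
by rewrite big_ord_recr /= IH exprS; field.
Qed.

(** In the ball the magnitudes have sum at most [4 n], so each point has weight at
    least 1 under [16 ^+ n * 2 ^- (sum of magnitudes)]; that weight is a product over
    coordinates, each of which sums to at most 64. *)
Lemma card_ball (R : realType) n :
  \sum_(v : lattice_vec n | in_ball v) (1 : R) <= 64 ^+ n.
Proof.
pose F (x : bool * 'I_(2 * n).+1) : R := 16 * 2^-1 ^+ x.2.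
have F0 x : 0 <= F x by rewrite mulr_ge0 ?exprn_ge0 ?invr_ge0.
apply: (@le_trans _ _ (\sum_(v : lattice_vec n) \prod_i F (v i))).
  rewrite big_mkcond; apply: ler_sum => v _.
  case: ifP => [vB|_]; last by apply: prodr_ge0.
  rewrite /F big_split /= prodr_const card_ord.
  have -> : \prod_i (2^-1 : R) ^+ (v i).2 = 2^-1 ^+ (\sum_i mag v i).
    by rewrite expr_sum.
  have -> : (16 : R) ^+ n = 2 ^+ (4 * n) by rewrite exprM; congr (_ ^+ n); ring.
  (* a natural number is at most its square *)
  have le4n : (\sum_i mag v i <= 4 * n)%N.
    apply: leq_trans vB; apply: leq_sum => i _.
    by rewrite -{1}[mag v i]expn1; case: (mag v i) => // k; rewrite leq_pexp2l.
  rewrite exprVn -[leLHS](@divff _ (2 ^+ (\sum_i mag v i))) ?expf_neq0 //.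
  by rewrite ler_wpM2r ?invr_ge0 ?exprn_ge0 // ler_weXn2l // ler1n.
rewrite -(bigA_distr_bigA (fun _ x => F x)) prodr_const card_ord.
apply: lerXn2r; rewrite ?nnegrE ?sumr_ge0 //.
rewrite /F -(pair_bigA _ (fun (b : bool) (k : 'I_(2 * n).+1) => 16 * (2^-1 : R) ^+ k)) /=.
rewrite big_bool /= -big_distrr /=; have := sum_pow2V R (2 * n).+1; lra.
Qed.

(** The part of the centred bilinear form carried by the pairs whose coefficient is
    at most [sd]. *)
Definition light_sum (R : realType) n (pr : 'I_n * 'I_n -> R) (sd : R)
    (v w : lattice_vec n) (f : {ffun 'I_n * 'I_n -> bool}) : R :=
  \sum_e (if (mag v e.1 * mag w e.2)%:R <= sd
          then lat R v e.1 * lat R w e.2 * ((f e)%:R - pr e) else 0).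

Definition light_ok (R : realType) n (pr : 'I_n * 'I_n -> R) (sd K : R)
    (f : {ffun 'I_n * 'I_n -> bool}) : bool :=
  [forall x : lattice_vec n * lattice_vec n,
     (in_ball x.1 && in_ball x.2) ==>
     (light_sum pr sd x.1 x.2 f <= K * n%:R * sd)].

(** Chernoff's bound with exponents [v_i w_j / sd], which light pairs keep in
    [-1, 1].  The quadratic term contributes at most
    [2 (al / n) * |v|^2 |w|^2 <= 32 al n]. *)
Lemma light_tail (R : realType) n (pr : 'I_n * 'I_n -> R) (al sd K : R) v w :
  (0 < n)%N -> 0 <= al -> 0 < sd ->
  (forall e, 0 <= pr e <= 1) -> (forall e, pr e <= al * sd ^+ 2 / n%:R) ->
  in_ball v -> in_ball w ->
  bern_prob pr (fun f => K * n%:R * sd < light_sum pr sd v w f)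
    <= expR (32 * al * n%:R - K * n%:R).
Proof.
move=> n0 al0 sd0 pr01 prle vB wB.
have n0R : 0 < (n%:R : R) by rewrite ltr0n.
pose c (e : 'I_n * 'I_n) : R := if (mag v e.1 * mag w e.2)%:R <= sd
          then lat R v e.1 * lat R w e.2 / sd else 0.
have c1 e : `|c e| <= 1.
  rewrite /c; case: ifP; rewrite ?normr0 // => le.
  rewrite normrM normrM !normr_lat normfV (gtr0_norm sd0) -natrM.
  by rewrite ler_pdivrMr // mul1r.
have lsE f : light_sum pr sd v w f = sd * (\sum_e c e * (f e)%:R - \sum_e pr e * c e).
  rewrite -sumrB mulr_sumr; apply: eq_bigr => e _; rewrite /c.
  case: ifP => _; last by rewrite mul0r mulr0 subr0 mulr0.
  by field; rewrite gt_eqF.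
apply: (@le_trans _ _ (bern_prob pr (fun f =>
    K * n%:R + \sum_e pr e * c e <= \sum_e c e * (f e)%:R))).
  apply: bern_prob_le => // f; rewrite lsE mulrC ltr_pM2l // ltrBrDr.
  exact: ltW.
apply: le_trans (chernoff c _ pr01) _; rewrite ler_expR.
suff : \sum_e pr e * (expR (c e) - 1) - \sum_e pr e * c e <= 32 * al * n%:R by lra.
rewrite -sumrB.
apply: (@le_trans _ _ (\sum_(e : 'I_n * 'I_n)
    2 * (al / n%:R) * (lat R v e.1 ^+ 2 * lat R w e.2 ^+ 2))).
  apply: ler_sum => e _.
  have p0 : 0 <= pr e by case/andP: (pr01 e).
  have h := expR_le_quadratic (c1 e).
  have c2 : c e ^+ 2 <= lat R v e.1 ^+ 2 * lat R w e.2 ^+ 2 / sd ^+ 2.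
    rewrite /c; case: ifP => _; first by rewrite !exprMn exprVn.
    by rewrite expr0n /= divr_ge0 ?sqr_ge0 // mulr_ge0 ?sqr_ge0.
  apply: (@le_trans _ _ (pr e * (2 * c e ^+ 2))).
    rewrite -mulrBr ler_wpM2l //; lra.
  apply: (@le_trans _ _ (al * sd ^+ 2 / n%:R *
     (2 * (lat R v e.1 ^+ 2 * lat R w e.2 ^+ 2 / sd ^+ 2)))).
    by apply: ler_pM => //; [rewrite mulr_ge0 ?sqr_ge0 | rewrite ler_pM2l].
  rewrite le_eqVlt; apply/orP; left; apply/eqP; field.
  by rewrite !gt_eqF.
rewrite -mulr_sumr.
rewrite -(pair_bigA _ (fun i j => lat R v i ^+ 2 * lat R w j ^+ 2)) /=.
under eq_bigr => i _ do rewrite -mulr_sumr.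
rewrite -mulr_suml.
apply: (@le_trans _ _ (2 * (al / n%:R) * (4 * n%:R * (4 * n%:R)))).
  rewrite ler_wpM2l ?mulr_ge0 ?invr_ge0 ?ler0n //.
  by apply: ler_pM; rewrite ?sum_sqr_lat ?sumr_ge0 // => i _; rewrite sqr_ge0.
rewrite le_eqVlt; apply/orP; left; apply/eqP; field.
by rewrite gt_eqF.
Qed.

(** There are at most [64 ^+ (2 n) <= expR (12 n)] pairs of lattice points, and each
    fails with probability at most [expR (- 16 n)]. *)
Lemma light_fail (R : realType) n (pr : 'I_n * 'I_n -> R) (al sd : R) :
  (0 < n)%N -> 0 <= al -> 0 < sd ->
  (forall e, 0 <= pr e <= 1) -> (forall e, pr e <= al * sd ^+ 2 / n%:R) ->
  bern_prob pr (fun f => ~~ light_ok pr sd (32 * al + 16) f)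
    <= expR (- (4 * n%:R)).
Proof.
move=> n0 al0 sd0 pr01 prle; set K := 32 * al + 16.
apply: (@le_trans _ _ (bern_prob pr (fun f => [exists x : lattice_vec n * lattice_vec n,
    (in_ball x.1 && in_ball x.2) && (K * n%:R * sd < light_sum pr sd x.1 x.2 f)]))).
  apply: bern_prob_le => // f; rewrite /light_ok negb_forall => /existsP[x].
  by rewrite negb_imply -ltNge => h; apply/existsP; exists x.
apply: le_trans (bern_prob_exists _ _ pr01) _.
apply: (@le_trans _ _ (\sum_(x : lattice_vec n * lattice_vec n |
    in_ball x.1 && in_ball x.2) expR (- (16 * n%:R)))).
  apply: ler_sum => x /andP[xB yB].
  apply: le_trans (light_tail K n0 al0 sd0 pr01 prle xB yB) _.
  by rewrite ler_expR /K; lra.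
rewrite -(pair_big _ _ (fun v w => expR (- (16 * n%:R)))) /=.
set S : R := \sum_(v : lattice_vec n | in_ball v) 1.
have sumC (x : R) : \sum_(v : lattice_vec n | in_ball v) x = S * x.
  by rewrite mulr_suml; apply: eq_bigr => v _; rewrite mul1r.
rewrite (eq_bigr _ (fun v _ => sumC _)) sumC mulrA.
have S0 : 0 <= S by apply: sumr_ge0.
have Sle : S <= expR (6 * n%:R).
  apply: le_trans (card_ball R n) _.
  have -> : 6 * n%:R = (n%:R * 6 : R) by ring.
  rewrite expRM_natl lerXn2r ?nnegrE ?expR_ge0 //.
  have -> : (64 : R) = 2 ^+ 6 by ring.
  have -> : (6 : R) = 6%:R * 1 by ring.
  rewrite expRM_natl lerXn2r ?nnegrE ?expR_ge0 //.
  by have := expR_ge1Dx (1 : R); lra.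
apply: (@le_trans _ _ (expR (6 * n%:R) * expR (6 * n%:R) * expR (- (16 * n%:R)))).
  by rewrite ler_wpM2r ?expR_ge0 // ler_pM.
by rewrite -!expRD ler_expR; lra.
Qed.

(** * Discrepancy *)

(** An upper bound for the logarithm of the number of [b]-element subsets of an
    [n]-element set. *)
Definition entropy (R : realType) (n b : nat) : R := b%:R * (1 + ln (n%:R / b%:R)).

Lemma entropy_le (R : realType) n a b :
  (0 < a)%N -> (a <= b)%N -> (b <= n)%N -> entropy R n a <= entropy R n b.
Proof.
move=> a0 ab bn; have b0 : (0 < b)%N by apply: leq_trans ab.
have n0 : (0 < n)%N by apply: leq_trans bn.
have aR : 0 < (a%:R : R) by rewrite ltr0n.
have bR : 0 < (b%:R : R) by rewrite ltr0n.
have nR : 0 < (n%:R : R) by rewrite ltr0n.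
rewrite /entropy; set c : R := b%:R / a%:R; set y : R := n%:R / b%:R.
have c1 : 1 <= c by rewrite /c ler_pdivlMr // mul1r ler_nat.
have y1 : 1 <= y by rewrite /y ler_pdivlMr // mul1r ler_nat.
have -> : (b%:R : R) = c * a%:R by rewrite /c divfK // gt_eqF.
have -> : (n%:R / a%:R : R) = y * c.
  by rewrite /y /c mulrA divfK // gt_eqF.
rewrite lnM ?posrE; [|lra|lra].
have lc : ln c <= c - 1.
  by have := @le_ln1Dx _ (c - 1); rewrite [1 + _]addrC subrK; apply; lra.
have ly : 0 <= ln y by rewrite ln_ge0.
have := mulr_ge0 (_ : 0 <= c - 1) ly; rewrite subr_ge0 => /(_ c1) h.
rewrite [c * _]mulrC -mulrA ler_pM2l //; lra.
Qed.

Lemma entropy_ge_ln (R : realType) n a :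
  (0 < a)%N -> (a <= n)%N -> ln n%:R <= entropy R n a.
Proof.
move=> a0 an; apply: le_trans (entropy_le R (isT : 0 < 1)%N a0 an).
rewrite /entropy divr1 mul1r; lra.
Qed.

(** A single term of the binomial expansion of [(1 + a / n) ^+ n <= expR a]. *)
Lemma bin_le_entropy (R : realType) n a :
  (0 < a)%N -> (a <= n)%N -> 'C(n, a)%:R <= expR (entropy R n a).
Proof.
move=> a0 an; have n0 : (0 < n)%N by apply: leq_trans an.
have aR : 0 < (a%:R : R) by rewrite ltr0n.
have nR : 0 < (n%:R : R) by rewrite ltr0n.
set x : R := a%:R / n%:R; have x0 : 0 < x by rewrite divr_gt0.
have h : 'C(n, a)%:R * x ^+ a <= expR a%:R.
  apply: (@le_trans _ _ ((1 + x) ^+ n)).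
    rewrite exprDn (bigD1 (Ordinal (_ : a < n.+1)%N)) //= expr1n mul1r mulr_natl lerDl.
    by apply: sumr_ge0 => i _; rewrite expr1n mul1r mulrn_wge0 // exprn_ge0 // ltW.
  have -> : (a%:R : R) = n%:R * x by rewrite /x mulrC divfK // gt_eqF.
  rewrite expRM_natl; apply: lerXn2r; rewrite ?nnegrE ?expR_ge0 ?expR_ge1Dx //.
  lra.
rewrite /entropy mulrDr mulr1 expRD -ler_pdivrMr ?expR_gt0 //.
rewrite mulrC expRM_natl lnK ?posrE ?divr_gt0 //.
by rewrite -exprVn invf_div mulrC.
Qed.

Definition edges n (f : {ffun 'I_n * 'I_n -> bool}) (I J : {set 'I_n}) : nat :=
  (\sum_(e in finset.setX I J) f e)%N.

(** The discrepancy alternative for two sets of sizes [a] and [b] joined by [l]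
    edges, when the edge density is at most [rho]: either [l] is at most a constant
    times its expected value, or the large deviation cost of [l] edges does not exceed
    a constant times the entropy of the choice of the two sets. *)
Definition disc_bound (R : realType) n (rho : R) (a b l : nat) : bool :=
  (l%:R <= expR 2 * (rho * a%:R * b%:R)) ||
  (l%:R * ln (l%:R / (rho * a%:R * b%:R)) <= 8 * (entropy R n a + entropy R n b)).

Definition disc_ok (R : realType) n (rho : R) (f : {ffun 'I_n * 'I_n -> bool}) : bool :=
  [forall x : {set 'I_n} * {set 'I_n}, disc_bound n rho #|x.1| #|x.2| (edges f x.1 x.2)].

(** The edge counts violating the alternative need not form an up-set a priori, so
    the bound is taken at the least violating count [l]; with the exponent
    [ln (l / m)], [m] the expected count, Chernoff's bound is
    [expR (l - l ln (l / m))], and [ln (l / m) > 2]. *)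
Lemma disc_tail (R : realType) n (pr : 'I_n * 'I_n -> R) (rho : R) (I J : {set 'I_n}) :
  0 < rho -> (forall e, 0 <= pr e <= 1) -> (forall e, pr e <= rho) ->
  (0 < #|I|)%N -> (0 < #|J|)%N ->
  bern_prob pr (fun f => ~~ disc_bound n rho #|I| #|J| (edges f I J))
    <= expR (- (4 * entropy R n #|I|)) * expR (- (4 * entropy R n #|J|)).
Proof.
move=> rho0 pr01 prle I0 J0; rewrite -expRD.
set m : R := rho * #|I|%:R * #|J|%:R.
have m0 : 0 < m by rewrite !mulr_gt0 ?ltr0n.
have [ex|nex] := pselect (exists l, ~~ disc_bound n rho #|I| #|J| l); last first.
  rewrite /bern_prob big1 ?expR_ge0 // => f bad.
  by exfalso; apply: nex; exists (edges f I J).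
case: (ex_minnP ex) => l bad lmin.
apply: (@le_trans _ _ (bern_prob pr (fun f => (l <= edges f I J)%N))).
  by apply: bern_prob_le => // f; apply: lmin.
move: bad; rewrite /disc_bound -/m negb_or -!ltNge => /andP[l1 l2].
have l0 : 0 < l%:R :> R by apply: le_lt_trans l1; rewrite mulr_ge0 ?expR_ge0 // ltW.
have lm : expR 2 < l%:R / m by rewrite ltr_pdivlMr.
set lam := ln (l%:R / m) in l2 *.
have lam2 : 2 <= lam.
  by rewrite /lam -[leLHS]expRK ler_ln ?posrE ?expR_gt0 ?divr_gt0 // ltW.
pose c e := if e \in finset.setX I J then lam else 0.
apply: (@le_trans _ _ (bern_prob pr (fun f =>
    lam * l%:R <= \sum_e c e * (f e)%:R))).
  apply: bern_prob_le => // f le.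
  have -> : \sum_e c e * (f e)%:R = lam * (edges f I J)%:R.
    rewrite /edges natr_sum mulr_sumr [RHS]big_mkcond /=.
    by apply: eq_bigr => e _; rewrite /c; case: ifP; rewrite ?mul0r.
  by rewrite ler_wpM2l ?ler_nat //; lra.
apply: le_trans (chernoff c _ pr01) _; rewrite ler_expR.
have sumle : \sum_e pr e * (expR (c e) - 1) <= l%:R.
  apply: (@le_trans _ _ (\sum_(e in finset.setX I J) rho * (l%:R / m))).
    rewrite [leRHS]big_mkcond; apply: ler_sum => e _; rewrite /c.
    case: ifP => _; last by rewrite expR0 subrr mulr0.
    rewrite /lam lnK ?posrE ?divr_gt0 //; case/andP: (pr01 e) => p0 p1.
    have : expR 2 >= 1 :> R by have := expR_ge1Dx (2 : R); lra.
    by move=> e1; apply: ler_pM; rewrite ?prle //; lra.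
  rewrite sumr_const cardsX -[leLHS]mulr_natr natrM.
  by rewrite le_eqVlt; apply/orP; left; apply/eqP; rewrite /m; field; rewrite !gt_eqF ?ltr0n.
have : l%:R * 2 <= l%:R * lam by rewrite ler_pM2l.
lra.
Qed.

(** Union bound over pairs of nonempty sets.  The tail bound factorises over the two
    sets, and each factor beats the number of sets of a given size with a margin
    [expR (- 3 entropy) <= n ^- 3]. *)
Lemma disc_fail (R : realType) n (pr : 'I_n * 'I_n -> R) (rho : R) :
  (0 < n)%N -> 0 < rho -> (forall e, 0 <= pr e <= 1) -> (forall e, pr e <= rho) ->
  bern_prob pr (fun f => ~~ disc_ok rho f) <= n%:R ^- 4.
Proof.
move=> n0 rho0 pr01 prle.
have nR : 0 < (n%:R : R) by rewrite ltr0n.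
pose S (x : {set 'I_n} * {set 'I_n}) := (0 < #|x.1|)%N && (0 < #|x.2|)%N.
apply: (@le_trans _ _ (bern_prob pr (fun f => [exists x, S x &&
    ~~ disc_bound n rho #|x.1| #|x.2| (edges f x.1 x.2)]))).
  apply: bern_prob_le => // f; rewrite negb_forall => /existsP[x bad].
  apply/existsP; exists x; rewrite bad andbT /S.
  have [|] := boolP (_ && _) => //; rewrite negb_and -!eqn0Ngt => e0; exfalso.
  have ed0 : edges f x.1 x.2 = 0%N.
    rewrite /edges big_pred0 // => -[i j]; rewrite inE /=.
    by case/orP: e0 => /eqP/cards0_eq ->; rewrite inE ?andbF.
  by move: bad; rewrite ed0 /disc_bound !mulr_ge0 ?expR_ge0 // ltW.
apply: le_trans (bern_prob_exists _ _ pr01) _.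
apply: (@le_trans _ _ (\sum_(x | S x)
   expR (- (4 * entropy R n #|x.1|)) * expR (- (4 * entropy R n #|x.2|)))).
  by apply: ler_sum => x /andP[x1 x2]; apply: disc_tail.
rewrite -(pair_big (fun I : {set 'I_n} => 0 < #|I|)%N (fun I : {set 'I_n} => 0 < #|I|)%N
   (fun I J => expR (- (4 * entropy R n #|I|)) * expR (- (4 * entropy R n #|J|)))) /=.
under eq_bigr => I _ do rewrite -mulr_sumr.
rewrite -mulr_suml; set T := \sum_(I | _) _.
have T0 : 0 <= T by apply: sumr_ge0 => I _; apply: expR_ge0.
suff Tle : T <= n%:R ^- 2.
  have -> : n%:R ^- 4 = n%:R ^- 2 * n%:R ^- 2 :> R by field; rewrite gt_eqF.
  by apply: ler_pM.
rewrite /T (partition_big (fun I : {set 'I_n} => inord #|I| : 'I_n.+1) (fun a => 0 < a)%N) /=; last first.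
  by move=> I I0; rewrite inordK // ltnS -[leqRHS]card_ord max_card.
apply: (@le_trans _ _ (\sum_(a < n.+1 | (0 < a)%N) n%:R ^- 3)).
  apply: ler_sum => a a0; have an : (a <= n)%N by rewrite -ltnS.
  have -> : \sum_(I : {set 'I_n} | (0 < #|I|)%N && (inord #|I| == a)) expR (- (4 * entropy R n #|I|))
     = 'C(n, a)%:R * expR (- (4 * entropy R n a)).
    rewrite (eq_big (fun I : {set 'I_n} => I \in [set I : {set 'I_n} | #|I| == a]%SET)
      (fun=> expR (- (4 * entropy R n a)))).
    - by rewrite sumr_const card_draws card_ord [RHS]mulr_natl.
    - move=> I; rewrite inE -val_eqE /= inordK; last first.
        by rewrite ltnS -[leqRHS]card_ord max_card.
      by case: eqP => [->|_]; rewrite ?a0 ?andbF.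
    - move=> I /andP[_ /eqP <-]; rewrite inordK //.
      by rewrite ltnS -[leqRHS]card_ord max_card.
  apply: (@le_trans _ _ (expR (entropy R n a) * expR (- (4 * entropy R n a)))).
    by rewrite ler_wpM2r ?expR_ge0 // bin_le_entropy.
  have h := entropy_ge_ln R a0 an.
  rewrite -expRD; apply: (@le_trans _ _ (expR (- (3 * ln n%:R)))).
    by rewrite ler_expR; lra.
  by rewrite expRN expRM_natl lnK.
rewrite sumr_const; apply: (@le_trans _ _ (n%:R ^- 3 *+ n)).
  rewrite ler_wpMn2l ?invr_ge0 ?exprn_ge0 //.
  apply: (@leq_trans #|predC1 (ord0 : 'I_n.+1)|); last by rewrite cardC1 card_ord.
  by apply: subset_leq_card; apply/fintype.subsetP => a aP; rewrite !inE; apply: contraTN aP => /eqP ->.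
rewrite le_eqVlt; apply/orP; left; apply/eqP; rewrite -mulr_natr; field.
by rewrite gt_eqF.
Qed.

(** * Heavy pairs *)

(** A truncated geometric sum is dominated by its last term. *)
Lemma sum_pow2_lt (R : realType) (K : R) N :
  0 < K -> \sum_(s < N) (if 2 ^+ s < K then (2 : R) ^+ s else 0) <= 2 * K.
Proof.
move=> K0.
have sumlt M : \sum_(s < M) (2 : R) ^+ s <= 2 ^+ M.
  elim: M => [|M IH]; first by rewrite big_ord0 expr0.
  by rewrite big_ord_recr /= exprS; lra.
elim: N => [|N IH]; first by rewrite big_ord0; lra.
rewrite big_ord_recr /=; case: ifP => [ltK|_]; last by rewrite addr0.
apply: (@le_trans _ _ (2 ^+ N + 2 ^+ N)); last lra.
rewrite lerD2r; apply: le_trans (sumlt N); apply: ler_sum => s _.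
by case: ifP => // _; rewrite exprn_ge0.
Qed.

Lemma sum_pow2V_lt (R : realType) (K : R) N :
  0 < K -> \sum_(t < N) (if (2 ^+ t)^-1 < K then ((2 : R) ^+ t)^-1 else 0) <= 2 * K.
Proof.
elim: N K => [|N IH] K K0; first by rewrite big_ord0; lra.
rewrite big_ord_recl expr0 invr1.
case: ifPn => [K1|]; last first.
  rewrite -leNgt => K1; rewrite add0r.
  have := IH (2 * K); move/(_ (ltac:(lra))) => h.
  rewrite (eq_bigr (fun t : 'I_N => 2^-1 *
     (if (2 ^+ t)^-1 < 2 * K then (2 ^+ t)^-1 else 0))).
    by rewrite -mulr_sumr; lra.
  move=> t _; rewrite /= /bump /= add1n exprS invfM.
  have -> : (2^-1 * (2 ^+ t)^-1 < K) = ((2 ^+ t)^-1 < 2 * K).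
    by rewrite mulrC ltr_pdivrMr // [K * _]mulrC.
  by case: ifP => _; rewrite ?mulr0.
apply: (@le_trans _ _ 2); last lra.
rewrite -[leRHS](_ : 1 + 1 = 2) // lerD2l.
apply: (@le_trans _ _ (2^-1 * \sum_(t < N) (2^-1 : R) ^+ t)).
  rewrite mulr_sumr; apply: ler_sum => t _.
  rewrite /= /bump /= add1n exprVn -invfM -exprS.
  by case: ifP => // _; rewrite invr_ge0 exprn_ge0.
have := sum_pow2V R N; lra.
Qed.

(** Contribution of a pair of dyadic levels: [a] coordinates of size [X], [b >= a]
    coordinates of size [Y], and [e] edges between them.  With [r = e / m] the ratio
    to the expected count and [L = 1 + ln (n / b)], the four summands cover
    - [r <= expR 2] or [r <= X Y / sd]: the count is as expected, or exceeds it by no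
      more than the heaviness of the pair;
    - [L <= 4 ln r]: the alternative gives [e <= 64 b];
    - [L] comparable with [ln Y]: then [r <= 2 Y], which forces [X < 2 sd], and the
      alternative gives [e <= 32 b Y];
    - [b Y^2 / n] so small that [r <= n / (b Y^2)].
    The first summand is controlled by the two norms; each of the others is geometric
    in one of the two levels. *)
Lemma dyadic_term (R : realType) n (al sd : R) (a b e : nat) (X Y : R) :
  (0 < n)%N -> 0 < al -> 0 < sd -> 0 < X -> 1 <= Y ->
  (0 < a)%N -> (a <= b)%N -> (b <= n)%N ->
  sd < 4 * (X * Y) -> disc_bound n (al * sd ^+ 2 / n%:R) a b e ->
  X * Y * e%:R <=
    4 * expR 2 * al * sd / n%:R * ((a%:R * X ^+ 2) * (b%:R * Y ^+ 2))
    + 64 * (X * (Y * b%:R))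
    + (if X < 2 * sd then X * (32 * (b%:R * Y ^+ 2)) else 0)
    + al * sd ^+ 2 * (a%:R * X) * Y^-1.
Proof.
move=> n0 al0 sd0 X0 Y1 a0 ab bn adm.
have nR : 0 < (n%:R : R) by rewrite ltr0n.
have aR : 0 < (a%:R : R) by rewrite ltr0n.
have bR : 0 < (b%:R : R) by rewrite ltr0n; apply: leq_trans ab.
have Y0 : 0 < Y by lra.
have e20 : 1 <= expR 2 :> R by have := expR_ge1Dx (2 : R); lra.
set rho := al * sd ^+ 2 / n%:R; set m := rho * a%:R * b%:R.
have rho0 : 0 < rho by rewrite divr_gt0 // mulr_gt0 // exprn_gt0.
have m0 : 0 < m by apply: mulr_gt0 => //; apply: mulr_gt0.
set T1 := 4 * _ * _ * _ / _ * _; set T2 := 64 * _; set T3 := if _ then _ else _.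
set T4 := al * _ * _ * _.
have T10 : 0 <= T1.
  by rewrite /T1 !mulr_ge0 ?invr_ge0 ?sqr_ge0 ?expR_ge0 // ltW.
have T20 : 0 <= T2 by rewrite /T2 !mulr_ge0 // ltW.
have T30 : 0 <= T3.
  by rewrite /T3; case: ifP => // _; rewrite !mulr_ge0 ?sqr_ge0 // ltW.
have T40 : 0 <= T4 by rewrite /T4 !mulr_ge0 ?sqr_ge0 ?invr_ge0 // ltW.
have small (x : R) : x <= expR 2 -> e%:R <= x * m -> X * Y * e%:R <= T1.
  move=> xle le; apply: (@le_trans _ _ (X * Y * (expR 2 * m))).
    rewrite ler_wpM2l ?mulr_ge0 //; [exact: ltW|lra|].
    by apply: le_trans le _; rewrite ler_wpM2r // ltW.
  rewrite /T1 /m /rho.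
  have -> : X * Y * (expR 2 * (al * sd ^+ 2 / n%:R * a%:R * b%:R)) =
    (expR 2 * al * sd / n%:R * (a%:R * b%:R) * (X * Y)) * sd by ring.
  have -> : 4 * expR 2 * al * sd / n%:R * (a%:R * X ^+ 2 * (b%:R * Y ^+ 2)) =
    (expR 2 * al * sd / n%:R * (a%:R * b%:R) * (X * Y)) * (4 * (X * Y)) by ring.
  rewrite ler_wpM2l ?(ltW adm) //.
  by rewrite !mulr_ge0 ?invr_ge0 ?expR_ge0 // ltW.
case/orP => [|]; rewrite -/rho -/m; first by move/(small _ (lexx _)); lra.
set r := e%:R / m => elnr.
(* [r] is made opaque so that [ln r] is not split into a difference below *)
have eE : e%:R = r * m by rewrite /r divfK // gt_eqF.
clearbody r.
have [rsmall|rbig] := leP r (expR 2).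
  by have := small _ rsmall; rewrite eE => /(_ (lexx _)); lra.
have r0 : 0 < r by apply: lt_trans rbig; rewrite expR_gt0.
have e0 : 0 <= (e%:R : R) by rewrite ler0n.
(* here [e] exceeds its mean by the factor [expR 2], and the entropy side applies *)
have lnr2 : 2 <= ln r by rewrite -[leLHS]expRK ler_ln ?posrE ?expR_gt0 // ltW.
have entab := entropy_le R a0 ab bn.
have le16 : e%:R * ln r <= 16 * (b%:R * (1 + ln (n%:R / b%:R))).
  by apply: le_trans elnr _; move: entab; rewrite {2 4}/entropy; lra.
set L := 1 + ln (n%:R / b%:R) in le16 *.
have [L4|L4] := leP L (4 * ln r).
  have e64 : e%:R <= 64 * b%:R :> R.
    have lnr0 : 0 < ln r by lra.
    rewrite -(ler_pM2r lnr0).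
    apply: le_trans le16 _.
    have := ler_wpM2l (ltW bR) L4; lra.
  have : X * Y * e%:R <= T2.
    have -> : T2 = X * Y * (64 * b%:R) by rewrite /T2; ring.
    by rewrite ler_wpM2l // mulr_ge0 // ltW.
  by lra.
have lnY0 : 0 <= ln Y by rewrite ln_ge0.
have lnY : ln Y <= Y - 1.
  by have := @le_ln1Dx _ (Y - 1); rewrite [1 + _]addrC subrK; apply; lra.
(* is [n / b] at most of the order of [Y ^+ 4], that is, is [ln (n / b)] governed by
   [ln Y] *)
have [L2|L2] := leP L (2 * (1 + 2 * ln Y)).
  have [rh|rh] := leP r (X * Y / sd).
    have : X * Y * e%:R <= T1.
      have xy2 : X * Y * e%:R <= X * Y * (X * Y / sd * m).
        by rewrite ler_wpM2l ?mulr_ge0 ?(ltW X0) ?(ltW Y0) // eE ler_wpM2r // ltW.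
      apply: le_trans xy2 _.
      have -> : X * Y * (X * Y / sd * m) =
         al * sd / n%:R * ((a%:R * X ^+ 2) * (b%:R * Y ^+ 2)).
        by rewrite /m /rho; field; rewrite !gt_eqF.
      rewrite /T1 ler_wpM2r //.
        by rewrite !mulr_ge0 ?sqr_ge0 // ltW.
      have -> : 4 * expR 2 * al * sd / n%:R = 4 * expR 2 * (al * sd / n%:R) by ring.
      rewrite ler_peMl //; last lra.
      by apply: ltW; rewrite divr_gt0 // mulr_gt0.
    by lra.
  have r2Y : r <= 2 * Y.
    rewrite -[leLHS](lnK r0) -[Y in leRHS](lnK Y0).
    apply: (@le_trans _ _ (expR (2^-1) * expR (ln Y))).
      by rewrite -expRD ler_expR; lra.
    rewrite ler_wpM2r ?expR_ge0 //.
    have := @expR_le_quadratic R 2^-1; rewrite ger0_norm; last lra.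
    by move/(_ ltac:(lra)) => h; apply: le_trans h _; lra.
  have X2 : X < 2 * sd.
    have : X * Y / sd < 2 * Y by lra.
    rewrite ltr_pdivrMr // => h; rewrite -(ltr_pM2r Y0); lra.
  have : X * Y * e%:R <= T3.
    rewrite /T3 X2.
    have -> : X * (32 * (b%:R * Y ^+ 2)) = X * Y * (16 * b%:R * (2 * Y)) by ring.
    rewrite ler_wpM2l ?mulr_ge0 ?(ltW X0) ?(ltW Y0) //.
    have h1 : e%:R * 2 <= e%:R * ln r by rewrite ler_wpM2l.
    have h2 : b%:R * L <= b%:R * (2 * (2 * Y)).
      by rewrite ler_wpM2l ?(ltW bR) //; lra.
    lra.
  lra.
have : X * Y * e%:R <= T4.
  have bY : r <= n%:R / (b%:R * Y ^+ 2).
    have pos : 0 < n%:R / (b%:R * Y ^+ 2) by rewrite divr_gt0 ?mulr_gt0 ?exprn_gt0.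
    rewrite -ler_ln ?posrE //.
    have -> : n%:R / (b%:R * Y ^+ 2) = n%:R / b%:R / Y / Y by field; rewrite !gt_eqF.
    rewrite !ln_div ?posrE ?divr_gt0 //.
    have : L = 1 + (ln n%:R - ln b%:R) by rewrite /L ln_div ?posrE.
    lra.
  have -> : X * Y * e%:R = (X * Y * m) * r by rewrite eE; ring.
  have -> : T4 = X * Y * m * (n%:R / (b%:R * Y ^+ 2)).
    by rewrite /T4 /m /rho; field; rewrite !gt_eqF.
  by rewrite ler_wpM2l // !mulr_ge0 // ltW.
lra.
Qed.

Definition dyadic_const (R : realType) (al : R) : R :=
  64 * expR 2 * al + 32 * al + 1536.

(** In each geometric contribution the geometric level is summed first, and the other
    one by the bound on the Euclidean norm. *)
Lemma dyadic_sum (R : realType) (N n : nat) (al sd : R) (a b : 'I_N -> nat)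
    (e : 'I_N -> 'I_N -> nat) :
  (0 < n)%N -> 0 < al -> 0 < sd ->
  \sum_s (a s)%:R * (2 ^+ s) ^+ 2 <= 4 * n%:R :> R ->
  \sum_t (b t)%:R * (2 ^+ t) ^+ 2 <= 4 * n%:R :> R ->
  (forall t, b t <= n)%N ->
  (forall s t, a s = 0%N -> e s t = 0%N) ->
  (forall s t, disc_bound n (al * sd ^+ 2 / n%:R) (a s) (b t) (e s t)) ->
  \sum_s \sum_t (if [&& (a s <= b t)%N, 2 ^+ s < 2 * sd * 2 ^+ t &
                       sd < 4 * (2 ^+ s * 2 ^+ t)]
                 then 2 ^+ s * 2 ^+ t * (e s t)%:R else 0)
    <= dyadic_const al * n%:R * sd.
Proof.
move=> n0 al0 sd0 sa sb bn e0 disc.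
have nR : 0 < (n%:R : R) by rewrite ltr0n.
have p2 (s : 'I_N) : 0 < (2 : R) ^+ s by rewrite exprn_gt0.
pose A s : R := (a s)%:R * (2 ^+ s) ^+ 2.
pose B t : R := (b t)%:R * (2 ^+ t) ^+ 2.
have A0 s : 0 <= A s by rewrite mulr_ge0 ?sqr_ge0.
have B0 t : 0 <= B t by rewrite mulr_ge0 ?sqr_ge0.
pose T1 s t : R := 4 * expR 2 * al * sd / n%:R * (A s * B t).
pose T2 (s t : 'I_N) : R := if 2 ^+ s < 2 * sd * 2 ^+ t then 64 * (2 ^+ s * (2 ^+ t * (b t)%:R)) else 0.
pose T3 (s t : 'I_N) : R := if 2 ^+ s < 2 * sd then 2 ^+ s * (32 * B t) else 0.
pose T4 (s t : 'I_N) : R := if (2 ^+ t)^-1 < 4 * 2 ^+ s / sd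
  then al * sd ^+ 2 * ((a s)%:R * 2 ^+ s) * (2 ^+ t)^-1 else 0.
have T10 s t : 0 <= T1 s t.
  by rewrite /T1 !mulr_ge0 ?invr_ge0 ?expR_ge0 ?A0 ?B0 // ltW.
have T20 s t : 0 <= T2 s t.
  by rewrite /T2; case: ifP => // _; rewrite !mulr_ge0 // ltW.
have T30 s t : 0 <= T3 s t.
  by rewrite /T3; case: ifP => // _; rewrite !mulr_ge0 ?B0 // ltW.
have T40 s t : 0 <= T4 s t.
  by rewrite /T4; case: ifP => // _; rewrite !mulr_ge0 ?invr_ge0 // ltW.
apply: (@le_trans _ _ (\sum_s \sum_t (T1 s t + T2 s t + T3 s t + T4 s t))).
  apply: ler_sum => s _; apply: ler_sum => t _.
  have pos : 0 <= T1 s t + T2 s t + T3 s t + T4 s t by rewrite !addr_ge0.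
  case: ifP => // /and3P[ab adm1 adm2].
  have [as0|as0] := posnP (a s); first by rewrite e0 // mulr0.
  have := dyadic_term n0 al0 sd0 (p2 s) (_ : 1 <= 2 ^+ t) as0 ab (bn t) adm2 (disc s t).
  rewrite exprn_ege1 ?ler1n // => /(_ isT); rewrite -/(A s) -/(B t) -/(T1 s t) => h.
  apply: le_trans h _; rewrite /T2 adm1 /T3 /T4.
  have -> : (2 ^+ t)^-1 < 4 * 2 ^+ s / sd.
    rewrite ltr_pdivlMr // mulrC ltr_pdivrMr //.
    by move: adm2; rewrite mulrA.
  exact: lexx.
have -> : \sum_s \sum_t (T1 s t + T2 s t + T3 s t + T4 s t) =
   \sum_s \sum_t T1 s t + \sum_t \sum_s T2 s t + \sum_t \sum_s T3 s t + \sum_s \sum_t T4 s t.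
  rewrite [\sum_t \sum_s T2 s t]exchange_big [\sum_t \sum_s T3 s t]exchange_big /=.
  rewrite -!big_split /=; apply: eq_bigr => s _; by rewrite -!big_split.
have h1 : \sum_s \sum_t T1 s t <= 64 * expR 2 * al * n%:R * sd.
  rewrite /T1; under eq_bigr => s _ do rewrite -mulr_sumr -mulr_sumr.
  rewrite -mulr_sumr -mulr_suml.
  apply: (@le_trans _ _ (4 * expR 2 * al * sd / n%:R * (4 * n%:R * (4 * n%:R)))).
    rewrite ler_wpM2l //; first by rewrite !mulr_ge0 ?invr_ge0 ?expR_ge0 // ltW.
    by apply: ler_pM; rewrite ?sumr_ge0.
  by rewrite le_eqVlt; apply/orP; left; apply/eqP; field; rewrite gt_eqF.
have h2 : \sum_t \sum_s T2 s t <= 1024 * n%:R * sd.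
  apply: (@le_trans _ _ (\sum_t 256 * sd * B t)); last first.
    rewrite -mulr_sumr.
    have := @ler_wpM2l _ (256 * sd) _ _ _ sb; rewrite mulr_ge0 ?(ltW sd0) // => /(_ isT).
    by move=> h; apply: le_trans h _; lra.
  apply: ler_sum => t _.
  have := sum_pow2_lt N (_ : 0 < 2 * sd * 2 ^+ t); rewrite !mulr_gt0 // => /(_ isT) h.
  have c0 : 0 <= 64 * (2 ^+ t * (b t)%:R) :> R by rewrite !mulr_ge0 // ltW.
  have := ler_wpM2l c0 h; rewrite mulr_sumr => h'.
  apply: le_trans (_ : _ <= 64 * (2 ^+ t * (b t)%:R) * (2 * (2 * sd * 2 ^+ t))) _.
    apply: le_trans h'; apply: ler_sum => s _; rewrite /T2.
    by case: ifP => _; rewrite ?mulr0 //; lra.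
  by rewrite /B le_eqVlt; apply/orP; left; apply/eqP; ring.
have h3 : \sum_t \sum_s T3 s t <= 512 * n%:R * sd.
  apply: (@le_trans _ _ (\sum_t 128 * sd * B t)); last first.
    rewrite -mulr_sumr.
    have := @ler_wpM2l _ (128 * sd) _ _ _ sb; rewrite mulr_ge0 ?(ltW sd0) // => /(_ isT).
    by move=> h; apply: le_trans h _; lra.
  apply: ler_sum => t _.
  have := sum_pow2_lt N (_ : 0 < 2 * sd); rewrite !mulr_gt0 // => /(_ isT) h.
  have c0 : 0 <= 32 * B t by rewrite mulr_ge0 ?B0.
  have := ler_wpM2l c0 h; rewrite mulr_sumr => h'.
  apply: le_trans (_ : _ <= 32 * B t * (2 * (2 * sd))) _; last by lra.
  apply: le_trans h'; apply: ler_sum => s _; rewrite /T3.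
  by case: ifP => _; rewrite ?mulr0 //; lra.
have h4 : \sum_s \sum_t T4 s t <= 32 * al * n%:R * sd.
  apply: (@le_trans _ _ (\sum_s 8 * al * sd * A s)); last first.
    rewrite -mulr_sumr.
    have := @ler_wpM2l _ (8 * al * sd) _ _ _ sa.
    rewrite !mulr_ge0 ?(ltW sd0) ?(ltW al0) // => /(_ isT).
    by move=> h; apply: le_trans h _; lra.
  apply: ler_sum => s _.
  have := sum_pow2V_lt N (_ : 0 < 4 * 2 ^+ s / sd).
  rewrite !divr_gt0 ?mulr_gt0 // => /(_ isT) h.
  have c0 : 0 <= al * sd ^+ 2 * ((a s)%:R * 2 ^+ s).
    by rewrite !mulr_ge0 // ltW.
  have := ler_wpM2l c0 h; rewrite mulr_sumr => h'.
  apply: le_trans (_ : _ <= al * sd ^+ 2 * ((a s)%:R * 2 ^+ s) * (2 * (4 * 2 ^+ s / sd))) _.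
    apply: le_trans h'; apply: ler_sum => t _; rewrite /T4.
    by case: ifP => _; rewrite ?mulr0 //; lra.
  rewrite /A le_eqVlt; apply/orP; left; apply/eqP; field.
  by rewrite gt_eqF.
rewrite /dyadic_const; lra.
Qed.

Lemma trunc_log2_bounds v : (0 < v)%N ->
  (2 ^ trunc_log 2 v <= v < 2 * 2 ^ trunc_log 2 v)%N.
Proof.
by move=> v0; rewrite -expnS; apply: trunc_log_bounds.
Qed.

(** The dyadic level of a nonzero coordinate.  It is meaningless on zero coordinates,
    which [level_set] leaves out. *)
Definition level n (v : 'I_n -> nat) (i : 'I_n) : 'I_(2 * n).+1 :=
  inord (trunc_log 2 (v i)).

Definition level_set n (v : 'I_n -> nat) (s : 'I_(2 * n).+1) : {set 'I_n} :=
  [set i | (0 < v i)%N && (level v i == s)]%SET.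

Lemma level_bounds (R : realType) n (v : 'I_n -> nat) i :
  (\sum_i v i ^ 2 <= 4 * n)%N -> (0 < v i)%N ->
  (2 : R) ^+ level v i <= (v i)%:R < (2 : R) * 2 ^+ level v i.
Proof.
move=> vB v0; have n0 : (0 < n)%N by apply: leq_ltn_trans (ltn_ord i).
have v2n : (v i <= 2 * n)%N.
  rewrite -leq_sqr; apply: leq_trans (_ : 4 * n <= _)%N; last first.
    by rewrite expnMn leq_pmul2l // -{1}[n]expn1 leq_pexp2l.
  by apply: leq_trans vB; rewrite (bigD1 i) //= leq_addr.
have tle : (trunc_log 2 (v i) <= v i)%N.
  have /andP[h _] := trunc_log2_bounds v0.
  by apply: leq_trans h; apply: ltnW; apply: ltn_expl.
rewrite /level inordK; last by rewrite ltnS (leq_trans tle).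
have /andP[h1 h2] := trunc_log2_bounds v0.
by rewrite -natrX ler_nat h1 -natrM ltr_nat.
Qed.

Lemma sum_level_sqr (R : realType) n (v : 'I_n -> nat) :
  (\sum_i v i ^ 2 <= 4 * n)%N ->
  \sum_s #|level_set v s|%:R * (2 ^+ s) ^+ 2 <= 4 * n%:R :> R.
Proof.
move=> vB; apply: (@le_trans _ _ (\sum_i (v i)%:R ^+ 2)); last first.
  by rewrite -natrM; under eq_bigr do rewrite -natrX; rewrite -natr_sum ler_nat.
rewrite [leRHS](bigID (fun i => 0 < v i)%N) /= -[leLHS]addr0 lerD //; last first.
  by apply: sumr_ge0 => i _; rewrite sqr_ge0.
rewrite (partition_big (level v) xpredT) //=; apply: ler_sum => s _.
rewrite mulr_natl -sumr_const.
rewrite [leLHS](eq_bigl (fun i => (0 < v i)%N && (level v i == s))); last first.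
  by move=> i; rewrite inE.
apply: ler_sum => i /andP[v0 /eqP <-]; have /andP[h _] := level_bounds R vB v0.
by apply: lerXn2r; rewrite ?nnegrE ?exprn_ge0.
Qed.

Definition heavy_const (R : realType) (al C1 : R) : R :=
  8 * C1 + 8 * dyadic_const al.

(** Pairs in which one coordinate exceeds the other by a factor [sd]: the product is
    at most the square of the larger one over [sd], and the vertex of the larger one
    has degree at most [C1 sd^2]. *)
Lemma heavy_row (R : realType) (n : nat) (C1 sd : R) (v : 'I_n -> nat)
    (h g : 'I_n -> 'I_n -> R) :
  0 <= C1 -> 0 < sd -> (\sum_i v i ^ 2 <= 4 * n)%N ->
  (forall i, (0 < v i)%N -> \sum_j h i j <= C1 * sd ^+ 2) ->
  (forall i j, g i j <= (v i)%:R ^+ 2 / sd * h i j) ->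
  \sum_i \sum_j g i j <= 4 * C1 * n%:R * sd.
Proof.
move=> C10 sd0 vB hrow gle.
apply: (@le_trans _ _ (\sum_i (v i)%:R ^+ 2 * (C1 * sd))).
  apply: ler_sum => i _.
  apply: (@le_trans _ _ ((v i)%:R ^+ 2 / sd * \sum_j h i j)).
    by rewrite mulr_sumr; apply: ler_sum.
  have [->|v0] := posnP (v i); first by rewrite expr0n /= !mul0r.
  have -> : (v i)%:R ^+ 2 * (C1 * sd) = (v i)%:R ^+ 2 / sd * (C1 * sd ^+ 2).
    by field; rewrite gt_eqF.
  by rewrite ler_wpM2l ?hrow // divr_ge0 ?sqr_ge0 // ltW.
rewrite -mulr_suml.
have vR : \sum_i (v i)%:R ^+ 2 <= 4 * n%:R :> R.
  by rewrite -natrM; under eq_bigr do rewrite -natrX; rewrite -natr_sum ler_nat.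
apply: le_trans (ler_wpM2r (_ : 0 <= C1 * sd) vR) _; last lra.
by rewrite mulr_ge0 // ltW.
Qed.

(** Heavy pairs.  The unbalanced ones are controlled by the degrees alone.  On the
    balanced ones both vectors are cut into dyadic levels; [dyadic_sum] is applied
    once to the levels with [a <= b] and once, with the roles exchanged, to the
    others. *)
Lemma heavy_bound (R : realType) n (f : {ffun 'I_n * 'I_n -> bool})
    (al C1 sd : R) (v w : 'I_n -> nat) :
  (0 < n)%N -> 0 < al -> 0 <= C1 -> 0 < sd ->
  (\sum_i v i ^ 2 <= 4 * n)%N -> (\sum_i w i ^ 2 <= 4 * n)%N ->
  (forall i, (0 < v i)%N -> \sum_j (f (i, j))%:R <= C1 * sd ^+ 2) ->
  (forall j, (0 < w j)%N -> \sum_i (f (i, j))%:R <= C1 * sd ^+ 2) ->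
  disc_ok (al * sd ^+ 2 / n%:R) f ->
  \sum_i \sum_j (if sd < (v i * w j)%:R then (v i * w j)%:R * (f (i, j))%:R else 0)
    <= heavy_const al C1 * n%:R * sd.
Proof.
move=> n0 al0 C10 sd0 vB wB frow fcol disc.
pose g1 i j : R := if (w j)%:R * sd <= (v i)%:R then (v i * w j)%:R * (f (i, j))%:R else 0.
pose g2 i j : R := if (v i)%:R * sd <= (w j)%:R then (v i * w j)%:R * (f (i, j))%:R else 0.
(* neither coordinate exceeds the other by the factor [sd] *)
pose mid i j := [&& (v i)%:R < (w j)%:R * sd, (w j)%:R < (v i)%:R * sd & sd < (v i * w j)%:R].
pose g3 i j : R := if mid i j then (v i * w j)%:R * (f (i, j))%:R else 0.
have f0 i j : 0 <= (v i * w j)%:R * (f (i, j))%:R :> R by rewrite mulr_ge0.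
apply: (@le_trans _ _ (\sum_i \sum_j (g1 i j + g2 i j + g3 i j))).
  apply: ler_sum => i _; apply: ler_sum => j _; rewrite /g1 /g2 /g3 /mid.
  have := f0 i j; set x := _ * _ => x0.
  have [h1|h1] := leP ((w j)%:R * sd) (v i)%:R;
  have [h2|h2] := leP ((v i)%:R * sd) (w j)%:R;
  by case: ifP => _ //=; lra.
have -> : \sum_i \sum_j (g1 i j + g2 i j + g3 i j) =
    \sum_i \sum_j g1 i j + \sum_j \sum_i g2 i j + \sum_i \sum_j g3 i j.
  rewrite [\sum_j \sum_i g2 i j]exchange_big -!big_split /=.
  by apply: eq_bigr => i _; rewrite -!big_split.
have s1 : \sum_i \sum_j g1 i j <= 4 * C1 * n%:R * sd.
  apply: (heavy_row C10 sd0 vB frow) => i j; rewrite /g1; case: ifP => [le|_]; last first.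
    by rewrite mulr_ge0 // divr_ge0 ?sqr_ge0 // ltW.
  rewrite ler_wpM2r // natrM expr2 -mulrA ler_wpM2l //.
  by rewrite ler_pdivlMr.
have s2 : \sum_j \sum_i g2 i j <= 4 * C1 * n%:R * sd.
  apply: (heavy_row C10 sd0 wB fcol) => j i; rewrite /g2; case: ifP => [le|_]; last first.
    by rewrite mulr_ge0 // divr_ge0 ?sqr_ge0 // ltW.
  rewrite ler_wpM2r // natrM mulrC expr2 -mulrA ler_wpM2l //.
  by rewrite ler_pdivlMr.
suff s3 : \sum_i \sum_j g3 i j <= 8 * dyadic_const al * n%:R * sd.
  by rewrite /heavy_const; lra.
pose A := level_set v; pose B := level_set w.
pose e s t := edges f (A s) (B t).
have cardn (I : {set 'I_n}) : (#|I| <= n)%N by rewrite -[leqRHS]card_ord max_card.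
have discE s t : disc_bound n (al * sd ^+ 2 / n%:R) #|A s| #|B t| (e s t).
  by have /forallP/(_ (A s, B t)) := disc.
have e0 s t : (#|A s| = 0%N) \/ (#|B t| = 0%N) -> e s t = 0%N.
  by case=> /cards0_eq h; rewrite /e h /edges big_pred0 // => -[i j];
    rewrite finset.in_setX finset.in_set0 ?andbF.
have h1 := dyadic_sum n0 al0 sd0 (sum_level_sqr R vB) (sum_level_sqr R wB)
   (fun t => cardn _) (fun s t h => e0 s t (or_introl h)) discE.
have h2 := dyadic_sum (e := fun t s => e s t) n0 al0 sd0 (sum_level_sqr R wB) (sum_level_sqr R vB)
   (fun t => cardn _) (fun t s h => e0 s t (or_intror h)).
have {}h2 := h2 (fun t s => _).
have discE' t s : disc_bound n (al * sd ^+ 2 / n%:R) #|B t| #|A s| (e s t).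
  move: (discE s t); rewrite /disc_bound.
  by rewrite [_ * #|A s|%:R * _]mulrAC [entropy _ _ #|A s| + _]addrC.
have {}h2 := h2 discE'; rewrite exchange_big /= in h2.
pose adm (s t : 'I_(2 * n).+1) := [&& 2 ^+ s < 2 * sd * 2 ^+ t,
   (2 : R) ^+ t < 2 * sd * 2 ^+ s & sd < 4 * (2 ^+ s * 2 ^+ t)].
have s3 : \sum_i \sum_j g3 i j <=
    \sum_s \sum_t (if adm s t then 4 * (2 ^+ s * 2 ^+ t * (e s t)%:R) else 0).
  have -> : \sum_i \sum_j g3 i j = \sum_(x | mid x.1 x.2) (v x.1 * w x.2)%:R * (f x)%:R.
    rewrite pair_bigA /= [RHS]big_mkcond /=; apply: eq_bigr => -[i j] _; by rewrite /g3.
  rewrite (partition_big (fun x => (level v x.1, level w x.2)) xpredT) //=.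
  rewrite pair_bigA; apply: ler_sum => -[s t] _ /=.
  have lev i j : mid i j -> (level v i, level w j) == (s, t) ->
     [/\ (0 < v i)%N, (0 < w j)%N, level v i = s, level w j = t & adm s t].
    move=> /and3P[m1 m2 m3] /eqP[ls lt].
    have : 0 < (v i * w j)%:R :> R by apply: lt_trans m3.
    rewrite ltr0n muln_gt0 => /andP[v0 w0]; split => //.
    have /andP[] := level_bounds R vB v0; rewrite ls => a1 a2.
    have /andP[] := level_bounds R wB w0; rewrite lt => b1 b2.
    have b3 := ler_wpM2r (ltW sd0) b1; have b4 : (w j)%:R * sd < 2 * 2 ^+ t * sd by rewrite ltr_pM2r.
    have a4 : (v i)%:R * sd < 2 * 2 ^+ s * sd by rewrite ltr_pM2r.
    apply/and3P; split; [lra|lra|].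
    apply: lt_trans m3 _; rewrite natrM.
    have -> : 4 * (2 ^+ s * 2 ^+ t) = (2 * 2 ^+ s) * (2 * 2 ^+ t) :> R by ring.
    by apply: ltr_pM.
  case: ifPn => [ad|nad]; last first.
    by rewrite big_pred0 // => -[i j]; apply/negbTE/negP => /andP[m l];
      case: (lev i j m l) => _ _ _ _; apply/negP.
  rewrite /e /edges natr_sum !mulr_sumr big_mkcond [leRHS]big_mkcond /=.
  apply: ler_sum => -[i j] _; case: ifP => [/andP[m l]|_]; last first.
    by case: ifP => // _; rewrite !mulr_ge0 ?exprn_ge0.
  have [v0 w0 ls lt _] := lev i j m l.
  rewrite !inE /= v0 w0 ls lt !eqxx /=.
  have /andP[_] := level_bounds R vB v0; rewrite ls => /ltW a2.
  have /andP[_] := level_bounds R wB w0; rewrite lt => /ltW b2.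
  have := ler_pM (ler0n _ _) (ler0n _ _) a2 b2; rewrite -natrM.
  case: (f (i, j)); rewrite ?mulr0 ?mulr1 //= => h; apply: le_trans h _; lra.
apply: le_trans s3 _.
set S1 := \sum_s \sum_t _ in h1; set S2 := \sum_j \sum_i _ in h2.
suff : \sum_s \sum_t (if adm s t then 4 * (2 ^+ s * 2 ^+ t * (e s t)%:R) else 0) <= 4 * (S1 + S2).
  by lra.
rewrite /S1 /S2 -big_split /= mulr_sumr; apply: ler_sum => s _.
rewrite -big_split /= mulr_sumr; apply: ler_sum => t _; rewrite -/(e s t) -/(A s) -/(B t).
have x0 : 0 <= 2 ^+ s * 2 ^+ t * (e s t)%:R :> R by rewrite !mulr_ge0 ?exprn_ge0.
have y0 : 0 <= 2 ^+ t * 2 ^+ s * (e s t)%:R :> R by rewrite !mulr_ge0 ?exprn_ge0.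
have xy : 2 ^+ t * 2 ^+ s * (e s t)%:R = 2 ^+ s * 2 ^+ t * (e s t)%:R :> R by ring.
case: ifP => [/and3P[d1 d2 d3]|_]; last first.
  by rewrite mulr_ge0 // addr_ge0 //; case: ifP.
rewrite d1 d2 d3 [2 ^+ t * 2 ^+ s]mulrC d3 !andbT.
have [ab|ba] := leqP #|A s| #|B t|; first by case: ifP => _; lra.
by rewrite (ltnW ba); lra.
Qed.

(** * Spectral norm of the trimmed adjacency matrix *)

Lemma nat_ceil (R : realType) (y : R) : 0 <= y ->
  exists m : nat, y <= m%:R < y + 1.
Proof.
move=> y0; have /andP[h1 h2] := Num.Theory.truncn_itv y0.
have [yE|yN] := eqVneq y (Num.truncn y)%:R.
  by exists (Num.truncn y); rewrite {1}yE lexx -yE /=; lra.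
exists (Num.truncn y).+1; rewrite (ltW h2) /= -natr1 ltrD2r lt_neqAle h1.
by rewrite eq_sym yN.
Qed.

(** Rounding for a linear form [g]: a coordinate that helps ([x_i g_i >= 0]) is
    rounded away from 0 and any other is replaced by 0.  This never decreases the
    form, keeps zeros, and sends the unit ball into the ball of radius 2 because each
    scaled coordinate grows by less than 1. *)
Lemma lattice_rounding (R : realType) n (x g : 'I_n -> R) :
  \sum_i x i ^+ 2 <= 1 ->
  exists v : lattice_vec n, [/\ in_ball v,
    forall i, (0 < mag v i)%N -> x i != 0 &
    Num.sqrt n%:R * \sum_i x i * g i <= \sum_i lat R v i * g i].
Proof.
move=> xB; set q := Num.sqrt (n%:R : R).
have q0 : 0 <= q by apply: sqrtr_ge0.
have qq : q ^+ 2 = n%:R by rewrite sqr_sqrtr.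
have /choice[m mP] : forall i, exists m : nat, q * `|x i| <= m%:R < q * `|x i| + 1.
  by move=> i; apply: nat_ceil; rewrite mulr_ge0.
have msq : (\sum_i m i ^ 2 <= 4 * n)%N.
  rewrite -(ler_nat R) natr_sum natrM.
  apply: (@le_trans _ _ (\sum_i (2 * n%:R * x i ^+ 2 + 2))).
    apply: ler_sum => i _; rewrite natrX -qq.
    have /andP[_ /ltW h] := mP i.
    apply: (@le_trans _ _ ((q * `|x i| + 1) ^+ 2)).
      by apply: lerXn2r; rewrite ?nnegrE ?addr_ge0 ?mulr_ge0.
    have -> : x i ^+ 2 = `|x i| ^+ 2 by rewrite real_normK ?num_real.
    have := sqr_ge0 (q * `|x i| - 1); nra.
  rewrite big_split /= sumr_const card_ord -mulr_sumr -[2 *+ n]mulr_natr.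
  have := ler_wpM2l (_ : 0 <= 2 * n%:R :> R) xB.
  rewrite mulr_ge0 // => /(_ isT); lra.
have m2n i : (m i <= 2 * n)%N.
  have n0 : (0 < n)%N by apply: leq_ltn_trans (ltn_ord i).
  rewrite -leq_sqr; apply: leq_trans (_ : 4 * n <= _)%N; last first.
    by rewrite expnMn leq_pmul2l // -{1}[n]expn1 leq_pexp2l.
  by apply: leq_trans msq; rewrite (bigD1 i) //= leq_addr.
pose v : lattice_vec n := [ffun i =>
  if 0 <= x i * g i then (x i < 0, inord (m i)) else (false, ord0)].
have magv i : mag v i = if 0 <= x i * g i then m i else 0%N.
  by rewrite /mag ffunE; case: ifP => //= _; rewrite inordK // ltnS.
exists v; split.
- apply: leq_trans msq; apply: leq_sum => i _; rewrite magv.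
  by case: ifP.
- move=> i; rewrite magv; case: ifP => // _; apply: contraTN => /eqP x0.
  have /andP[_] := mP i; rewrite x0 normr0 mulr0 add0r ltrn1.
  by case: (m i).
- rewrite mulr_sumr; apply: ler_sum => i _.
  rewrite /lat magv ffunE; case: ifPn => [xg0|]; last first.
    by rewrite -ltNge => /ltW h; rewrite mulr0 mul0r mulr_ge0_le0.
  have /andP[h _] := mP i; have [xn|xp] /= := ltP (x i) 0.
    rewrite ltr0_norm // in h; rewrite expr1 mulN1r mulrA.
    have g0 : g i <= 0 by move: xg0; rewrite nmulr_rge0.
    by rewrite ler_wnM2r //; lra.
  rewrite expr0 mul1r mulrA; rewrite ger0_norm // in h.
  have [x0|xN] := eqVneq (x i) 0.
    have /andP[_] := mP i; rewrite x0 normr0 !mulr0 mul0r add0r ltrn1.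
    by case: (m i) => // _; rewrite mul0r.
  have xp' : 0 < x i by rewrite lt_neqAle eq_sym xN.
  by rewrite ler_wpM2r // -(pmulr_rge0 _ xp').
Qed.

Definition core_const (R : realType) (al C1 : R) : R :=
  48 * al + 16 + heavy_const al C1.

(** Rounding [x] against [W y] and then [y] against [v^T W] reduces the bilinear form
    to lattice points, where it splits into light and heavy pairs.  The mean of the
    heavy pairs is small because [v_i w_j <= (v_i w_j)^2 / sd] there.  Since
    rounding keeps zeros, only vertices of [G], whose degrees are bounded, matter. *)
Lemma core_bound (R : realType) n (f : {ffun 'I_n * 'I_n -> bool})
    (pr : 'I_n * 'I_n -> R) (al C1 sd : R) (G : {set 'I_n}) (x y : 'I_n -> R) :
  (0 < n)%N -> 0 < al -> 0 <= C1 -> 0 < sd ->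
  (forall e, 0 <= pr e <= al * sd ^+ 2 / n%:R) ->
  light_ok pr sd (32 * al + 16) f -> disc_ok (al * sd ^+ 2 / n%:R) f ->
  (forall i, i \in G -> \sum_j (f (i, j))%:R <= C1 * sd ^+ 2) ->
  (forall j, j \in G -> \sum_i (f (i, j))%:R <= C1 * sd ^+ 2) ->
  \sum_i x i ^+ 2 <= 1 -> \sum_i y i ^+ 2 <= 1 ->
  (forall i, x i != 0 -> i \in G) -> (forall i, y i != 0 -> i \in G) ->
  \sum_i \sum_j x i * y j * ((f (i, j))%:R - pr (i, j)) <= core_const al C1 * sd.
Proof.
move=> n0 al0 C10 sd0 prB light disc frow fcol xB yB xG yG.
have nR : 0 < (n%:R : R) by rewrite ltr0n.
pose W i j : R := (f (i, j))%:R - pr (i, j).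
have [v [vB vx hv]] := lattice_rounding (fun i => \sum_j W i j * y j) xB.
have [w [wB wy hw]] := lattice_rounding (fun j => \sum_i lat R v i * W i j) yB.
have q0 : 0 <= Num.sqrt (n%:R : R) by apply: sqrtr_ge0.
have hv' : Num.sqrt n%:R * \sum_i \sum_j x i * y j * W i j <=
   \sum_j y j * (\sum_i lat R v i * W i j).
  have -> : \sum_i \sum_j x i * y j * W i j = \sum_i x i * \sum_j W i j * y j.
    by apply: eq_bigr => i _; rewrite mulr_sumr; apply: eq_bigr => j _; ring.
  apply: le_trans hv _; rewrite le_eqVlt; apply/orP; left; apply/eqP.
  under eq_bigr => i _ do rewrite mulr_sumr.
  under [RHS]eq_bigr => j _ do rewrite mulr_sumr.
  by rewrite exchange_big; apply: eq_bigr => j _; apply: eq_bigr => i _; ring.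
have {hv hw} h : n%:R * \sum_i \sum_j x i * y j * W i j <=
    \sum_i \sum_j lat R v i * lat R w j * W i j.
  have -> : n%:R = Num.sqrt n%:R * Num.sqrt (n%:R : R) by rewrite -expr2 sqr_sqrtr.
  rewrite -mulrA; apply: le_trans (ler_wpM2l q0 hv') _.
  apply: le_trans hw _; rewrite le_eqVlt; apply/orP; left; apply/eqP.
  under eq_bigr => i _ do rewrite mulr_sumr.
  by rewrite exchange_big; apply: eq_bigr => j _; apply: eq_bigr => i _; ring.
rewrite -(ler_pM2l nR); apply: le_trans h _.
have lightvw : light_sum pr sd v w f <= (32 * al + 16) * n%:R * sd.
  by have /forallP/(_ (v, w))/implyP := light; rewrite /= vB wB; apply.
have heavy := heavy_bound (v := mag v) (w := mag w) n0 al0 C10 sd0 vB wB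
  (fun i vi => frow i (xG i (vx i vi))) (fun j wj => fcol j (yG j (wy j wj))) disc.
set H := \sum_i \sum_j _ in heavy.
have heavyP : \sum_i \sum_j al * sd / n%:R * (lat R v i ^+ 2 * lat R w j ^+ 2) <=
    16 * al * n%:R * sd.
  under eq_bigr => i _ do rewrite -mulr_sumr -mulr_sumr.
  rewrite -mulr_sumr -mulr_suml.
  apply: (@le_trans _ _ (al * sd / n%:R * (4 * n%:R * (4 * n%:R)))).
    rewrite ler_wpM2l //; first by rewrite !mulr_ge0 ?invr_ge0 // ltW.
    by apply: ler_pM; rewrite ?sum_sqr_lat ?sumr_ge0 // => i _; rewrite sqr_ge0.
  by rewrite le_eqVlt; apply/orP; left; apply/eqP; field; rewrite gt_eqF.
set HP := \sum_i \sum_j _ in heavyP.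
suff : \sum_i \sum_j lat R v i * lat R w j * W i j <= light_sum pr sd v w f + H + HP.
  by rewrite /core_const; lra.
have -> : light_sum pr sd v w f = \sum_i \sum_j
   (if (mag v i * mag w j)%:R <= sd then lat R v i * lat R w j * W i j else 0).
  by rewrite pair_bigA; apply: eq_bigr => -[i j] _.
rewrite /H /HP -!big_split; apply: ler_sum => i _ /=.
rewrite -!big_split; apply: ler_sum => j _ /=.
have hp0 : 0 <= al * sd / n%:R * (lat R v i ^+ 2 * lat R w j ^+ 2).
  apply: mulr_ge0; last by apply: mulr_ge0; apply: sqr_ge0.
  by apply: divr_ge0 => //; apply: mulr_ge0; apply: ltW.
case: leP => [_|hvw]; first by rewrite addr0 lerDl.
rewrite add0r /W; have /andP[p0 p1] := prB (i, j).
have F0 : 0 <= (f (i, j))%:R :> R by [].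
apply: (@le_trans _ _ ((mag v i * mag w j)%:R * ((f (i, j))%:R + pr (i, j)))).
  apply: le_trans (ler_norm _) _; rewrite normrM [X in X * _]normrM !normr_lat -natrM ler_wpM2l //.
  by rewrite ler_norml; apply/andP; split; lra.
rewrite mulrDr lerD2l !sqr_lat -!natrX -natrM -expnMn natrX.
set z := (mag v i * mag w j)%:R in hvw *.
have z0 : 0 < z by apply: lt_trans hvw.
apply: le_trans (ler_wpM2l (ltW z0) p1) _.
have -> : al * sd / n%:R * z ^+ 2 = z * (al * sd / n%:R) * z by ring.
have -> : z * (al * sd ^+ 2 / n%:R) = z * (al * sd / n%:R) * sd by ring.
by rewrite ler_wpM2l ?(ltW hvw) // !mulr_ge0 ?invr_ge0 // ltW.
Qed.

(** Few vertices have a large degree.  They form a set [J] with many edges to the set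
    of all vertices, more than [expR 2] times the expected number because [C1] is
    large; the discrepancy alternative then bounds the number of these edges by
    [8 n]. *)
Lemma card_high_degree (R : realType) n (f : {ffun 'I_n * 'I_n -> bool})
    (al C1 sd : R) (J : {set 'I_n}) (I1 I2 : {set 'I_n}) :
  (0 < n)%N -> 0 < al -> 2 * expR 2 * al < C1 -> 0 < sd ->
  disc_ok (al * sd ^+ 2 / n%:R) f ->
  (I1, I2) = (J, [set: 'I_n]%SET) \/ (I1, I2) = ([set: 'I_n]%SET, J) ->
  #|J|%:R * (C1 * sd ^+ 2 / 2) <= (edges f I1 I2)%:R ->
  #|J|%:R <= 16 * n%:R / (C1 * sd ^+ 2).
Proof.
move=> n0 al0 C1al sd0 disc IJ degJ.
have nR : 0 < (n%:R : R) by rewrite ltr0n.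
have e20 : 0 < expR 2 :> R by apply: expR_gt0.
have C10 : 0 < C1 by apply: lt_trans C1al; rewrite !mulr_gt0.
have sd2 : 0 < sd ^+ 2 by rewrite exprn_gt0.
have [J0|J0] := posnP #|J|.
  by rewrite J0 divr_ge0 ?mulr_ge0 // ltW // mulr_gt0.
have Jn : (#|J| <= n)%N by rewrite -[leqRHS]card_ord max_card.
have JR : 0 < (#|J|%:R : R) by rewrite ltr0n.
set e := edges f I1 I2 in degJ; set m := al * sd ^+ 2 * #|J|%:R.
have m0 : 0 < m by rewrite !mulr_gt0.
have big : expR 2 * m < #|J|%:R * (C1 * sd ^+ 2 / 2).
  have -> : expR 2 * m = #|J|%:R * sd ^+ 2 / 2 * (2 * expR 2 * al).
    by rewrite /m; field.
  have -> : #|J|%:R * (C1 * sd ^+ 2 / 2) = #|J|%:R * sd ^+ 2 / 2 * C1 by field.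
  by rewrite ltr_pM2l // !mulr_gt0.
have lnr : e%:R * ln (e%:R / m) <= 16 * n%:R -> 2 * e%:R <= 16 * n%:R :> R.
  move=> h; apply: le_trans h; rewrite mulrC ler_wpM2l //.
  have er : expR 2 <= e%:R / m by rewrite ler_pdivlMr // (le_trans (ltW big)).
  by rewrite -[leLHS]expRK ler_ln ?posrE // (lt_le_trans e20 er).
have ent : entropy R n #|J| <= n%:R.
  apply: le_trans (entropy_le R J0 Jn (leqnn n)) _.
  by rewrite /entropy divff ?gt_eqF // ln1 addr0 mulr1.
have entn : entropy R n n <= n%:R.
  by rewrite /entropy divff ?gt_eqF // ln1 addr0 mulr1.
have e8 : 2 * e%:R <= 16 * n%:R :> R.
  have /forallP/(_ (I1, I2)) := disc; rewrite /= -/e /disc_bound.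
  have -> : al * sd ^+ 2 / n%:R * #|I1|%:R * #|I2|%:R = m.
    by case: IJ => -[-> ->]; rewrite cardsT card_ord /m; field; rewrite gt_eqF.
  have -> : entropy R n #|I1| + entropy R n #|I2| = entropy R n #|J| + entropy R n n.
    by case: IJ => -[-> ->]; rewrite cardsT card_ord // addrC.
  case/orP => [le|le]; last by apply: lnr; apply: le_trans le _; lra.
  by have := lt_le_trans big (le_trans degJ le); rewrite ltxx.
rewrite ler_pdivlMr ?mulr_gt0 //; lra.
Qed.

Definition op_const (R : realType) (al C1 cd : R) : R :=
  2 * core_const al C1 + al * (1 + 32 / C1) + cd.

(** Young's inequality with weight [c], to be balanced against the size of [J]. *)
Lemma cross_bound (R : realType) n (c : R) (x y : 'I_n -> R) (J : {set 'I_n}) :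
  0 < c -> \sum_i x i ^+ 2 <= 1 -> \sum_i y i ^+ 2 <= 1 ->
  \sum_(i in J) \sum_j `|x i| * `|y j| <= (c * n%:R + #|J|%:R / c) / 2.
Proof.
move=> c0 xB yB.
apply: (@le_trans _ _ (\sum_(i in J) \sum_j (c * x i ^+ 2 + y j ^+ 2 / c) / 2)).
  apply: ler_sum => i _; apply: ler_sum => j _.
  rewrite -[x i ^+ 2]real_normK ?num_real // -[y j ^+ 2]real_normK ?num_real //.
  have : 0 <= c * (`|x i| - `|y j| / c) ^+ 2 by rewrite mulr_ge0 ?sqr_ge0 // ltW.
  have -> : c * (`|x i| - `|y j| / c) ^+ 2 =
    c * `|x i| ^+ 2 + `|y j| ^+ 2 / c - 2 * (`|x i| * `|y j|).
    by field; rewrite gt_eqF.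
  lra.
have -> : \sum_(i in J) \sum_j (c * x i ^+ 2 + y j ^+ 2 / c) / 2 =
   (c * n%:R * \sum_(i in J) x i ^+ 2 + #|J|%:R / c * \sum_j y j ^+ 2) / 2.
  under eq_bigr => i _.
    rewrite -mulr_suml big_split /= sumr_const card_ord -mulr_suml; over.
  rewrite -mulr_suml; congr (_ / 2); rewrite big_split /= sumr_const; congr (_ + _).
    by rewrite mulr_sumr; apply: eq_bigr => i _; rewrite -[LHS]mulr_natr; ring.
  by rewrite -[LHS]mulr_natr; ring.
have xJ : \sum_(i in J) x i ^+ 2 <= 1.
  apply: le_trans xB; rewrite [leRHS](bigID (fun i => i \in J)) /= lerDl.
  by apply: sumr_ge0 => i _; apply: sqr_ge0.
have h1 := ler_wpM2l (_ : 0 <= c * n%:R) xJ.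
have h2 := ler_wpM2l (_ : 0 <= #|J|%:R / c) yB.
have {}h1 := h1 ltac:(by rewrite mulr_ge0 // ltW).
have {}h2 := h2 ltac:(by rewrite divr_ge0 // ltW).
lra.
Qed.

(** Restricting [x] and [y] to the untrimmed vertices turns the form of the trimmed
    matrix into two core forms, one for each orientation of the edges.  What is
    missing from the mean is its restriction to the [O(n / sd^2)] trimmed rows and
    columns, and its diagonal. *)
Lemma trimmed_spectral_bound (R : realType) n (f : {ffun 'I_n * 'I_n -> bool})
    (pr : 'I_n * 'I_n -> R) (al C1 sd cd : R) (A Q : 'M[R]_n) (x y : 'I_n -> R) :
  (0 < n)%N -> 0 < al -> 2 * expR 2 * al < C1 -> 0 < sd -> 0 <= cd ->
  (forall e, 0 <= pr e <= al * sd ^+ 2 / n%:R) -> (forall i, pr (i, i) = 0) ->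
  light_ok pr sd (32 * al + 16) f -> disc_ok (al * sd ^+ 2 / n%:R) f ->
  (forall i j, A i j = (f (i, j))%:R + (f (j, i))%:R) ->
  (forall i j, i != j -> Q i j = pr (i, j) + pr (j, i)) ->
  (forall i j, i != j -> Q i j <= al * sd ^+ 2 / n%:R) ->
  (forall i, `|Q i i| <= cd * sd) ->
  \sum_i x i ^+ 2 <= 1 -> \sum_i y i ^+ 2 <= 1 ->
  \sum_i \sum_j x i * y j * (trim (C1 * sd ^+ 2) A i j - Q i j)
    <= op_const al C1 cd * sd.
Proof.
move=> n0 al0 C1al sd0 cd0 prB prD light disc AE QE Qle QD xB yB.
have nR : 0 < (n%:R : R) by rewrite ltr0n.
have e20 : 0 < expR 2 :> R by apply: expR_gt0.
have C10 : 0 < C1 by apply: lt_trans C1al; rewrite !mulr_gt0.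
have sd2 : 0 < sd ^+ 2 by rewrite exprn_gt0.
set tau := C1 * sd ^+ 2; set rho := al * sd ^+ 2 / n%:R in prB Qle *.
have tau0 : 0 < tau by rewrite mulr_gt0.
have rho0 : 0 < rho by rewrite divr_gt0 // mulr_gt0.
pose J := [set i | tau < \sum_l A i l]%SET.
(* a trimmed vertex has more than half of the threshold in one orientation *)
pose J1 := [set i | tau / 2 <= \sum_l (f (i, l))%:R]%SET.
pose J2 := [set i | tau / 2 <= \sum_l (f (l, i))%:R]%SET.
have edgesE (I1 I2 : {set 'I_n}) : (edges f I1 I2)%:R =
    \sum_(i in I1) \sum_(j in I2) (f (i, j))%:R :> R.
  rewrite /edges natr_sum pair_big /=; apply: eq_big => [[i j]|[i j] _] //.
  by rewrite finset.in_setX.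
have J1c : #|J1|%:R <= 16 * n%:R / tau.
  apply: (@card_high_degree _ _ f al C1 sd J1 J1 [set: 'I_n]%SET) => //; first by left.
  rewrite edgesE mulr_natl -sumr_const; apply: ler_sum => i; rewrite inE => h.
  by apply: le_trans h _; rewrite le_eqVlt; apply/orP; left; apply/eqP;
    apply: eq_bigl => j; rewrite finset.in_setT.
have J2c : #|J2|%:R <= 16 * n%:R / tau.
  apply: (@card_high_degree _ _ f al C1 sd J2 [set: 'I_n]%SET J2) => //; first by right.
  rewrite edgesE exchange_big /= mulr_natl -sumr_const; apply: ler_sum => i; rewrite inE => h.
  by apply: le_trans h _; rewrite le_eqVlt; apply/orP; left; apply/eqP;
    apply: eq_bigl => j; rewrite finset.in_setT.
have Jc : #|J|%:R <= 32 / C1 * n%:R / sd ^+ 2.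
  apply: (@le_trans _ _ (#|J1|%:R + #|J2|%:R)).
    rewrite -natrD ler_nat; apply: leq_trans (leq_card_setU J1 J2).1.
    apply: subset_leq_card; apply/fintype.subsetP => i; rewrite !inE => h.
    have [//|h1] := leP (tau / 2) (\sum_l (f (i, l))%:R).
    have [//|h2] := leP (tau / 2) (\sum_l (f (l, i))%:R).
    move: h; under eq_bigr => l _ do rewrite AE.
    by rewrite big_split /=; lra.
  have -> : 32 / C1 * n%:R / sd ^+ 2 = 16 * n%:R / tau + 16 * n%:R / tau.
    by rewrite /tau; field; rewrite !gt_eqF.
  exact: lerD.
pose G := (~: J)%SET.
have degG i : i \in G -> \sum_l (f (i, l))%:R <= tau /\ \sum_l (f (l, i))%:R <= tau.
  rewrite !inE -leNgt; under eq_bigr => l _ do rewrite AE.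
  rewrite big_split /= => h.
  have h1 : 0 <= \sum_l (f (i, l))%:R :> R by apply: sumr_ge0.
  have h2 : 0 <= \sum_l (f (l, i))%:R :> R by apply: sumr_ge0.
  by split; lra.
pose x' i := if i \in G then x i else 0.
pose y' i := if i \in G then y i else 0.
have restr (u : 'I_n -> R) : \sum_i u i ^+ 2 <= 1 ->
    \sum_i (if i \in G then u i else 0) ^+ 2 <= 1.
  apply: le_trans; apply: ler_sum => i _; case: ifP => // _.
  by rewrite expr0n sqr_ge0.
have restrG (u : 'I_n -> R) i : (if i \in G then u i else 0) != 0 -> i \in G.
  by case: ifP => //; rewrite eqxx.
have c1 := core_bound n0 al0 (ltW C10) sd0 prB light disc (fun i h => (degG i h).1)
  (fun i h => (degG i h).2) (restr _ xB) (restr _ yB) (restrG x) (restrG y).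
have c2 := core_bound n0 al0 (ltW C10) sd0 prB light disc (fun i h => (degG i h).1)
  (fun i h => (degG i h).2) (restr _ yB) (restr _ xB) (restrG y) (restrG x).
rewrite exchange_big /= in c2.
have isd0 : 0 < sd^-1 by rewrite invr_gt0.
have r1 := cross_bound J isd0 xB yB; have r2 := cross_bound J isd0 yB xB.
rewrite exchange_big /= in r2.
set S1 := \sum_i \sum_j _ in c1; set S2 := \sum_j \sum_i _ in c2.
set X1 := \sum_(i in J) _ in r1; set X2 := \sum_j _ in r2.
have diag : \sum_i `|x i| * `|y i| <= 1.
  apply: (@le_trans _ _ (\sum_i (x i ^+ 2 + y i ^+ 2) / 2)).
    apply: ler_sum => i _.
    rewrite -[x i ^+ 2]real_normK ?num_real // -[y i ^+ 2]real_normK ?num_real //.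
    have := sqr_ge0 (`|x i| - `|y i|); nra.
  by rewrite -mulr_suml big_split /=; lra.
have main : \sum_i \sum_j x i * y j * (trim tau A i j - Q i j) <=
    S1 + S2 + rho * X1 + rho * X2 + cd * sd * \sum_i `|x i| * `|y i|.
  have -> : X1 = \sum_i \sum_j (if i \in J then `|x i| * `|y j| else 0).
    rewrite /X1 big_mkcond; apply: eq_bigr => i _.
    by case: ifP => // _; rewrite big1.
  have -> : X2 = \sum_i \sum_j (if j \in J then `|x i| * `|y j| else 0).
    rewrite /X2; apply: eq_bigr => i _; rewrite big_mkcond; apply: eq_bigr => j _.
    by rewrite mulrC.
  have -> : \sum_i `|x i| * `|y i| = \sum_i \sum_j (if j == i then `|x i| * `|y j| else 0).
    by apply: eq_bigr => i _; rewrite -big_mkcond big_pred1_eq.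
  rewrite !mulr_sumr /S1 /S2 -!big_split; apply: ler_sum => i _ /=.
  rewrite !mulr_sumr -!big_split; apply: ler_sum => j _ /=.
  rewrite mxE -![tau < _](finset.in_set (fun i => tau < \sum_l A i l)) -/J.
  rewrite !finset.in_setC.
  have xy0 : 0 <= `|x i| * `|y j| by rewrite mulr_ge0.
  have rxy : 0 <= rho * (`|x i| * `|y j|) by rewrite mulr_ge0 // ltW.
  have cxy : 0 <= cd * sd * (`|x i| * `|y j|) by rewrite !mulr_ge0 // ltW.
  have [ij|ij] := eqVneq i j.
    subst j; rewrite AE prD.
    have : - (x i * y i * Q i i) <= cd * sd * (`|x i| * `|y i|).
      apply: le_trans (ler_norm _) _; rewrite normrN !normrM mulrC.
      by rewrite ler_wpM2r.
    by case: (i \in J) => /=; lra.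
  have Qij : 0 <= Q i j <= rho.
    rewrite Qle // andbT QE //; have /andP[? _] := prB (i, j).
    by have /andP[? _] := prB (j, i); rewrite addr_ge0.
  have qxy : - (x i * y j * Q i j) <= rho * (`|x i| * `|y j|).
    apply: le_trans (ler_norm _) _; rewrite normrN normrM mulrC normrM.
    by case/andP: Qij => q0 q1; rewrite ler_wpM2r // ger0_norm.
  rewrite AE; move: (QE i j ij) qxy => ->.
  by case: (i \in J); case: (j \in J) => /=; lra.
apply: le_trans main _.
(* the weight [c = sd^-1] balances [n] and [#|J| sd^2 = O(n)] *)
have Y (X : R) : X <= (sd^-1 * n%:R + #|J|%:R / sd^-1) / 2 ->
   rho * X <= al * (1 + 32 / C1) * sd / 2.
  move=> h; apply: le_trans (ler_wpM2l (ltW rho0) h) _.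
  have hJ := ler_wpM2l (ltW sd0) Jc.
  have -> : al * (1 + 32 / C1) * sd / 2 =
     rho * ((sd^-1 * n%:R + sd * (32 / C1 * n%:R / sd ^+ 2)) / 2).
    by rewrite /rho; field; rewrite !gt_eqF.
  rewrite ler_pM2l // ler_pM2r // lerD2l invrK mulrC //.
have y1 := Y _ r1; have y2 := Y _ r2.
have y3 : cd * sd * \sum_i `|x i| * `|y i| <= cd * sd.
  by rewrite -[leRHS]mulr1 ler_wpM2l // mulr_ge0 // ltW.
rewrite /op_const; lra.
Qed.

(** * Low-rank denoising *)

Lemma trace_mul_tr (R : realType) m n (A B : 'M[R]_(m, n)) :
  \tr (A *m B^T) = \sum_i \sum_j A i j * B i j.
Proof.
apply: eq_bigr => i _; rewrite mxE; apply: eq_bigr => j _; by rewrite mxE.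
Qed.

Lemma trace_sqr_sub (R : realType) m n (A B : 'M[R]_(m, n)) :
  \tr ((A - B) *m (A - B)^T) =
  \tr (A *m A^T) - 2 * \tr (B *m A^T) + \tr (B *m B^T).
Proof.
rewrite !trace_mul_tr mulr_sumr -sumrB -big_split; apply: eq_bigr => i _ /=.
rewrite mulr_sumr -sumrB -big_split; apply: eq_bigr => j _ /=.
by rewrite !mxE; ring.
Qed.

(** Gram-Schmidt, one row at a time. *)
Lemma orthonormal_basis (R : realType) n r (A : 'M[R]_(r, n)) :
  row_free A -> exists2 V : 'M[R]_(r, n), V *m V^T = 1%:M & (A <= V)%MS.
Proof.
elim: r A => [|r IH] A; first by exists A; [apply/matrixP => -[] | ].
move: A; rewrite -[r.+1]/(1 + r)%N => A Afree.
rewrite -[A]vsubmxK in Afree *; set a := usubmx _ in Afree *; set B := dsubmx _ in Afree *.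
have Bfree : row_free B.
  apply/inj_row_free => v vB.
  have : row_mx 0 v *m (col_mx a B) = 0 by rewrite mul_row_col mul0mx add0r.
  move/eqP; rewrite mulmx_free_eq0 // => /eqP /(congr1 rsubmx).
  by rewrite row_mxKr linear0.
have [V VV BV] := IH B Bfree.
pose u := a - a *m V^T *m V.
have uV : u *m V^T = 0 by rewrite mulmxBl -[a *m V^T *m V *m V^T]mulmxA VV mulmx1 subrr.
have u0 : u != 0.
  apply/eqP => u0; have aV : (a <= V)%MS.
    by rewrite -(subr0 a) -u0 opprB addrC subrK submxMl.
  have : (col_mx a B <= V)%MS by rewrite col_mx_sub aV.
  move/mxrankS; rewrite (eqP Afree) => h.
  by have := leq_trans h (rank_leq_row V); rewrite add1n ltnn.
have aE : a = u + a *m V^T *m V by rewrite subrK.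
clearbody u; pose s : R := \sum_j u 0 j ^+ 2.
have s0 : 0 < s.
  rewrite lt_neqAle sumr_ge0 ?andbT => [|j _]; last exact: sqr_ge0.
  apply: contra u0 => /eqP/esym s0; apply/eqP/rowP => j; rewrite [RHS]mxE.
  have /psumr_eq0P h := s0; apply/eqP; rewrite -[_ == _]sqrf_eq0; apply/eqP.
  by apply: h => // i _; apply: sqr_ge0.
have uu : u *m u^T = s%:M.
  apply/matrixP => i j; rewrite !mxE !ord1 eqxx mulr1n.
  by apply: eq_bigr => l _; rewrite mxE expr2.
pose u' := (Num.sqrt s)^-1 *: u.
have q0 : 0 < Num.sqrt s by rewrite sqrtr_gt0.
exists (col_mx u' V).
  rewrite tr_col_mx mul_col_row VV /u' linearZ /= -!scalemxAl -!scalemxAr uV.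
  have -> : V *m u^T = 0 by apply: trmx_inj; rewrite trmx_mul trmxK uV trmx0.
  rewrite uu !scaler0 scalerA -invfM -expr2 sqr_sqrtr ?(ltW s0) // scale_scalar_mx.
  by rewrite mulVf ?gt_eqF // -scalar_mx_block.
have /andP[sub1 sub2] : (u' <= col_mx u' V)%MS && (V <= col_mx u' V)%MS.
  by rewrite -col_mx_sub.
rewrite col_mx_sub (submx_trans BV) // andbT aE addmx_sub //.
  have -> : u = Num.sqrt s *: u' by rewrite /u' scalerA divff ?gt_eqF // scale1r.
  by rewrite scalemx_sub.
exact: submx_trans (submxMl _ _) _.
Qed.

(** Test the form against [x] proportional to [E y]. *)
Lemma bilinear_to_norm (R : realType) n (E : 'M[R]_n) (K : R) (y : 'I_n -> R) :
  0 <= K ->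
  (forall x, \sum_i x i ^+ 2 <= 1 -> \sum_i \sum_j x i * y j * E i j <= K) ->
  \sum_i (\sum_j E i j * y j) ^+ 2 <= K ^+ 2.
Proof.
move=> K0 bil; pose N i := \sum_j E i j * y j.
rewrite -/(\sum_i N i ^+ 2); set s := \sum_i _.
have s0 : 0 <= s by apply: sumr_ge0 => i _; apply: sqr_ge0.
have [->|sN] := eqVneq s 0; first by rewrite sqr_ge0.
have q0 : 0 < Num.sqrt s by rewrite sqrtr_gt0 lt_neqAle eq_sym sN.
have ss : Num.sqrt s ^+ 2 = s by rewrite sqr_sqrtr.
have := bil (fun i => N i / Num.sqrt s) _.
have -> : \sum_i (N i / Num.sqrt s) ^+ 2 = 1.
  under eq_bigr => i _ do rewrite exprMn exprVn ss.
  by rewrite -mulr_suml -/s divff.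
move/(_ (lexx _)).
have -> : \sum_i \sum_j N i / Num.sqrt s * y j * E i j = Num.sqrt s.
  transitivity (\sum_i N i ^+ 2 / Num.sqrt s).
    apply: eq_bigr => i _.
    have -> : N i ^+ 2 / Num.sqrt s = N i / Num.sqrt s * N i by rewrite expr2; ring.
    by rewrite {3}/N mulr_sumr; apply: eq_bigr => j _; ring.
  by rewrite -mulr_suml -/s -[X in X / _]ss expr2 mulfK ?gt_eqF.
by move=> sK; rewrite -ss; apply: lerXn2r => //; rewrite nnegrE // ltW.
Qed.

(** With [D = Phat - Q] and [E = X - Q], minimality of [Phat] reads
    [|D|^2 <= 2 <D, E>].  Projecting on the row space of [D], of dimension at most
    [2 k], leaves [<D, E>] unchanged and cuts the Frobenius norm of [E] down to at
    most [sqrt (2 k) K]. *)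
Lemma low_rank_denoising (R : realType) n k (X Phat Q : 'M[R]_n) (K : R) :
  low_rank_minimizer X k Phat -> (\rank Q <= k)%N -> 0 <= K ->
  (forall x y, \sum_i x i ^+ 2 <= 1 -> \sum_i y i ^+ 2 <= 1 ->
     \sum_i \sum_j x i * y j * (X i j - Q i j) <= K) ->
  \sum_i \sum_j (Phat i j - Q i j) ^+ 2 <= 8 * k%:R * K ^+ 2.
Proof.
move=> [rP minP] rQ K0 bil.
pose D := Phat - Q; pose E := X - Q.
have frobE (Y : 'M[R]_n) : frob_norm Y ^+ 2 = \tr (Y *m Y^T).
  rewrite /frob_norm sqr_sqrtr ?trace_mul_tr.
    by apply: eq_bigr => i _; apply: eq_bigr => j _; rewrite expr2.
  by apply: sumr_ge0 => i _; apply: sumr_ge0 => j _; apply: sqr_ge0.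
have DE : \tr (D *m D^T) <= 2 * \tr (D *m E^T).
  have := minP Q rQ; rewrite !frobE -/E.
  have -> : X - Phat = E - D by rewrite /E /D opprB addrA subrK.
  rewrite trace_sqr_sub; lra.
have rD : (\rank D <= k + k)%N.
  apply: leq_trans (mxrank_add _ _) _; rewrite mxrank_opp; exact: leq_add.
have [V VV DV] := orthonormal_basis (row_base_free D).
have {}DV : (D <= V)%MS by rewrite -(eq_row_base D).
have DVV : D *m V^T *m V = D.
  case/submxP: DV => Z DZ.
  by rewrite [X in X *m _ *m _]DZ -[Z *m V *m V^T]mulmxA VV mulmx1 -DZ.
pose M := D *m V^T; pose N := E *m V^T.
have MM : \tr (M *m M^T) = \tr (D *m D^T).
  by rewrite /M trmx_mul trmxK mulmxA DVV.
have MN : \tr (M *m N^T) = \tr (D *m E^T).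
  by rewrite /M /N trmx_mul trmxK mulmxA DVV.
have NN : \tr (N *m N^T) <= (\rank D)%:R * K ^+ 2.
  rewrite trace_mul_tr exchange_big /= mulr_natl -[X in _ *+ X]card_ord -sumr_const.
  apply: ler_sum => l _.
  have := @bilinear_to_norm R n E K (fun j => V l j) K0.
  have Vl : \sum_i V l i ^+ 2 <= 1.
    move/matrixP/(_ l l): VV; rewrite !mxE eqxx /= => h.
    rewrite -[leRHS]/(1%:R) -h le_eqVlt; apply/orP; left; apply/eqP.
    by apply: eq_bigr => j _; rewrite mxE expr2.
  move=> /(_ _)/le_trans-h; rewrite (eq_bigr (fun i => (\sum_j E i j * V l j) ^+ 2)).
    apply: h => // x xB; have := bil x (fun j => V l j) xB Vl.
    apply: le_trans; rewrite le_eqVlt; apply/orP; left; apply/eqP.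
    by apply: eq_bigr => i _; apply: eq_bigr => j _; rewrite !mxE.
  move=> i _; rewrite -expr2 [N i l]mxE; congr (_ ^+ 2).
  by apply: eq_bigr => j _; rewrite [V^T j l]mxE.
(* Young's inequality with a weight that lets half of [|D|^2] be absorbed *)
have amgm : 2 * \tr (M *m N^T) <= \tr (M *m M^T) / 2 + 2 * \tr (N *m N^T).
  rewrite !trace_mul_tr !mulr_sumr mulr_suml -big_split; apply: ler_sum => i _ /=.
  rewrite !mulr_sumr mulr_suml -big_split; apply: ler_sum => j _ /=.
  have := sqr_ge0 (M i j - 2 * N i j); nra.
have fin : \tr (D *m D^T) <= 8 * k%:R * K ^+ 2.
  have : (\rank D)%:R * K ^+ 2 <= 2 * k%:R * K ^+ 2.
    by rewrite ler_wpM2r ?sqr_ge0 // -natrM ler_nat mul2n -addnn.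
  move: MM MN amgm NN DE; lra.
apply: le_trans fin; rewrite trace_mul_tr le_eqVlt; apply/orP; left; apply/eqP.
by apply: eq_bigr => i _; apply: eq_bigr => j _; rewrite !mxE expr2.
Qed.

Lemma l1_error (R : realType) n k (D : 'M[R]_n) (K : R) :
  (0 < n)%N -> (0 < k)%N -> 0 < K ->
  \sum_i \sum_j D i j ^+ 2 <= 8 * k%:R * K ^+ 2 ->
  \sum_i \sum_j `|D i j| <= 9 / 2 * n%:R * Num.sqrt k%:R * K.
Proof.
move=> n0 k0 K0 DB; have nR : 0 < (n%:R : R) by rewrite ltr0n.
have q0 : 0 < Num.sqrt (k%:R : R) by rewrite sqrtr_gt0 ltr0n.
have qq : Num.sqrt (k%:R : R) ^+ 2 = k%:R by rewrite sqr_sqrtr.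
pose c := K * Num.sqrt k%:R / n%:R.
have c0 : 0 < c by rewrite divr_gt0 // mulr_gt0.
apply: (@le_trans _ _ (\sum_(i < n) \sum_(j < n) (c + D i j ^+ 2 / c) / 2)).
  apply: ler_sum => i _; apply: ler_sum => j _.
  rewrite -[D i j ^+ 2]real_normK ?num_real //.
  have : 0 <= (c - `|D i j|) ^+ 2 / c by rewrite divr_ge0 ?sqr_ge0 // ltW.
  have -> : (c - `|D i j|) ^+ 2 / c = c + `|D i j| ^+ 2 / c - 2 * `|D i j|.
    by field; rewrite gt_eqF.
  lra.
have -> : \sum_(i < n) \sum_(j < n) (c + D i j ^+ 2 / c) / 2 =
   (c * n%:R * n%:R + (\sum_i \sum_j D i j ^+ 2) / c) / 2.
  under eq_bigr => i _ do rewrite -mulr_suml big_split /= sumr_const card_ord -mulr_suml.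
  rewrite -mulr_suml; congr (_ / 2); rewrite big_split /= sumr_const card_ord -mulr_suml.
  by rewrite -[_ *+ n *+ n]mulr_natr -[_ *+ n]mulr_natr.
have : (\sum_i \sum_j D i j ^+ 2) / c <= 8 * k%:R * K ^+ 2 / c.
  by rewrite ler_pM2r // invr_gt0.
have -> : 8 * k%:R * K ^+ 2 / c = 8 * n%:R * Num.sqrt k%:R * K.
  rewrite /c; move: q0 qq; set q := Num.sqrt _ => q0 <-; field.
  by rewrite !gt_eqF.
have -> : c * n%:R * n%:R = n%:R * Num.sqrt k%:R * K.
  by rewrite /c; field; rewrite !gt_eqF.
lra.
Qed.

(** * Weighted k-medians *)

(** The label sets seen on the good vertices of different communities are disjoint,
    so there are at most [k] labels in total; hence communities with two labels or
    more ([split]) are at most as many as communities with none ([lost]).  The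
    permutation is one that hits the label set of as many communities as possible;
    if it missed a nonempty one, a transposition would improve it. *)
Lemma label_matching (n k : nat) (z : 'I_n -> 'I_k) (zh : 'I_n -> option 'I_k)
    (Gd : {set 'I_n}) :
  (forall i, i \in Gd -> zh i != None) ->
  (forall i j, i \in Gd -> j \in Gd -> z i != z j -> zh i != zh j) ->
  exists (s : {perm 'I_k}) (lost split : {set 'I_k}),
    [/\ (#|split| <= #|lost|)%N,
        forall i, i \in Gd -> z i \notin split -> zh i = Some (s (z i)) &
        forall i, i \in Gd -> z i \notin lost].
Proof.
move=> zhN zhneq.
pose lab u := [set l | [exists i in Gd, (z i == u) && (zh i == Some l)]]%SET.
have labP u l : reflect (exists i, [/\ i \in Gd, z i = u & zh i = Some l]) (l \in lab u).
  rewrite inE; apply: (iffP existsP) => [[i /and3P[iG /eqP zi /eqP hi]]|[i [iG <- hi]]].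
    by exists i.
  by exists i; rewrite iG eqxx hi eqxx.
have labD l u u' : l \in lab u -> l \in lab u' -> u = u'.
  move=> /labP[i [iG <- hi]] /labP[j [jG <- hj]]; apply/eqP.
  by apply: contraT => zij; have := zhneq i j iG jG zij; rewrite hi hj eqxx.
pose hit (s : {perm 'I_k}) := [set u | s u \in lab u]%SET.
have hitE t u : (u \in hit t) = (t u \in lab u) by rewrite finset.in_set.
pose s := [arg max_(s > (1 : {perm 'I_k})%g) #|hit s|].
have smax t : (#|hit t| <= #|hit s|)%N.
  by rewrite /s; case: arg_maxnP => // s0 _ max; apply: max.
have sin u : lab u != finset.set0 -> s u \in lab u.
  case/set0Pn => l lu; apply: contraT => su.
  (* [t] hits [u], and also every community hit by [s]: such a community has neither
     the value [s u] nor the value [l], which is a label of [u] only *)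
  pose t := (s * tperm (s u) l)%g.
  have : hit s \proper hit t.
    apply/properP; split.
      apply/fintype.subsetP => u'; rewrite !hitE => su'.
      have uu' : s u != s u' by apply: contraNN su => /eqP/perm_inj ->.
      have su'l : l != s u'.
        apply: contraNN su => /eqP ls; move: su'; rewrite -ls => lu'.
        by have uE := labD _ _ _ lu lu'; move: uu'; rewrite uE eqxx.
      by rewrite permM tpermD.
    by exists u; rewrite hitE // permM tpermL.
  by move/proper_card; rewrite ltnNge smax.
pose lost := [set u | lab u == finset.set0]%SET.
pose split := [set u | (1 < #|lab u|)%N]%SET.
have labz i l : i \in Gd -> zh i = Some l -> l \in lab (z i).
  by move=> iG hi; apply/labP; exists i.
exists s, lost, split; split.
- have sumlab : (\sum_u #|lab u| <= k)%N.
    have -> : (\sum_u #|lab u| = \sum_u \sum_l (l \in lab u))%N.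
      by apply: eq_bigr => u _; rewrite -sum1_card big_mkcond.
    rewrite exchange_big /= -[leqRHS]card_ord -sum1_card; apply: leq_sum => l _.
    have -> : (\sum_u (l \in lab u) = #|[pred u | l \in lab u]|)%N.
      by rewrite -sum1_card [RHS]big_mkcond.
    by apply/card_le1_eqP => u u'; rewrite !unfold_in => /labD h /h.
  rewrite -(leq_add2l k); apply: leq_trans (leq_add sumlab (leqnn _)).
  rewrite -{1}[k]card_ord -!sum1_card [X in (_ + X <= _)%N]big_mkcond.
  rewrite [X in (_ <= _ + X)%N]big_mkcond -!big_split /=; apply: leq_sum => u _.
  rewrite !inE -cards_eq0; case: (#|lab u|) => [|[|m]] //=.
- move=> i iG; rewrite inE -leqNgt => le1.
  case hi : (zh i) (zhN i iG) => [l|//] _.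
  have li := labz i l iG hi.
  have si : s (z i) \in lab (z i) by apply: sin; apply/set0Pn; exists l.
  by move/card_le1_eqP: le1 => /(_ l (s (z i)) li si) ->.
- move=> i iG; rewrite inE; apply/negP => /eqP lab0.
  case hi : (zh i) (zhN i iG) => [l|//] _.
  by have := labz i l iG hi; rewrite lab0 inE.
Qed.

Lemma l1norm_ge0 (R : realType) n (x : 'rV[R]_n) : 0 <= l1norm x.
Proof. by apply: sumr_ge0. Qed.

Lemma l1normN (R : realType) n (x : 'rV[R]_n) : l1norm (- x) = l1norm x.
Proof. by apply: eq_bigr => j _; rewrite mxE normrN. Qed.

Lemma l1normD (R : realType) n (x y : 'rV[R]_n) : l1norm (x + y) <= l1norm x + l1norm y.
Proof.
by rewrite /l1norm -big_split; apply: ler_sum => j _; rewrite mxE ler_normD.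
Qed.

Lemma l1normZ (R : realType) n (c : R) (x : 'rV[R]_n) : l1norm (c *: x) = `|c| * l1norm x.
Proof. by rewrite /l1norm mulr_sumr; apply: eq_bigr => j _; rewrite mxE normrM. Qed.

Lemma l1norm_sub_swap (R : realType) n (x y : 'rV[R]_n) : l1norm (x - y) = l1norm (y - x).
Proof. by rewrite -l1normN opprB. Qed.

Lemma l1norm_triangle (R : realType) n (x y t : 'rV[R]_n) :
  l1norm (x - y) <= l1norm (x - t) + l1norm (t - y).
Proof. by rewrite -[x - y](subrKA t) l1normD. Qed.

Lemma minval_le (R : realType) (T : Type) (F : T -> R) (x : T) :
  (forall y, 0 <= F y) -> minval F <= F x.
Proof.
move=> F0; apply: ge_inf; last by exists x.
by exists 0 => _ [y _ <-].
Qed.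

Lemma minval_approx (R : realType) (T : Type) (F : T -> R) (x : T) (eta : R) :
  (forall y, 0 <= F y) -> 0 < eta -> exists y, F y <= minval F + eta.
Proof.
move=> F0 eta0; have hasF : has_inf (range F).
  by split; [exists (F x); exists x | exists 0 => _ [y _ <-]].
by have [_ [y _ <-] /ltW h] := inf_adherent eta0 hasF; exists y.
Qed.

(** The weight in front of the distance undoes the normalisation of the row of
    [Phat]; the error made by normalising with [l1norm (row i Phat)] instead of
    [l1norm (row i Q)] is again at most the distance of the rows. *)
Lemma normalized_row_error (R : realType) n (Phat Q : 'M[R]_n) (w : 'rV[R]_n)
    (c : R) (i : 'I_n) :
  0 <= c -> l1norm w = 1 -> row i Q = c *: w -> i \notin zero_rows Phat ->
  l1norm (row i Phat) * l1norm (normalized_row Phat i - w)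
    <= 2 * l1norm (row i Phat - row i Q).
Proof.
move=> c0 w1 Qi; rewrite inE => rho0.
set rho := l1norm (row i Phat).
have rhop : 0 <= rho by apply: l1norm_ge0.
have -> : rho * l1norm (normalized_row Phat i - w) = l1norm (row i Phat - rho *: w).
  rewrite -[X in X * _](ger0_norm rhop) -l1normZ scalerBr /normalized_row scalerA.
  by rewrite divff // scale1r.
apply: le_trans (l1norm_triangle _ _ (row i Q)) _.
have h : l1norm (row i Q - rho *: w) <= l1norm (row i Phat - row i Q).
  rewrite {1}Qi -scalerBl l1normZ w1 mulr1.
  have Qc : l1norm (row i Q) = c by rewrite Qi l1normZ w1 mulr1 ger0_norm.
  have h1 := l1norm_triangle (row i Phat) 0 (row i Q).
  have h2 := l1norm_triangle (row i Q) 0 (row i Phat).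
  rewrite !subr0 -/rho Qc in h1 h2.
  rewrite [l1norm (row i Q - _)]l1norm_sub_swap in h2.
  by rewrite ler_norml; apply/andP; split; lra.
lra.
Qed.

(** The true centres are a competitor in the k-medians problem, of cost at most
    [2 F]; so the fitted centres have cost [O((1 + eps) F)], and by the triangle
    inequality so has the weighted distance between fitted and true centres.  Vertices
    where this distance reaches [Delta / 2] therefore carry little row mass, and so do
    those with a zero row; row mass dominates [b0] times [theta].  On the remaining
    vertices labels separate communities, and [label_matching] applies: a split
    community is paid for by a lost one, since community masses agree up to the factor
    [Gc]. *)
Lemma kmedian_recovery (R : realType) n k (theta : 'rV[R]_n) (z : 'I_n -> 'I_k)
    (zh : 'I_n -> option 'I_k) (Phat Q : 'M[R]_n) (w : 'I_k -> 'rV[R]_n)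
    (b : 'I_k -> R) (eps F Delta b0 g Gc : R) :
  (0 < k)%N -> 0 <= eps -> 0 < F -> 0 < Delta <= 2 -> 0 < b0 -> 0 <= Gc ->
  (forall i, 0 <= theta 0 i) ->
  (forall i, row i Q = (theta 0 i * b (z i)) *: w (z i)) ->
  (forall u, b0 <= b u) -> (forall u, l1norm (w u) = 1) ->
  (forall u v, u != v -> Delta <= l1norm (w u - w v)) ->
  \sum_i l1norm (row i Phat - row i Q) <= F ->
  (forall u, g <= \sum_(i | z i == u) theta 0 i <= Gc * g) ->
  (forall i, (zh i == None) = (i \in zero_rows Phat)) ->
  kmedian_cost Phat zh <= (1 + eps) *
    minval (fun z' : {ffun 'I_n -> 'I_k} => kmedian_cost Phat (fun i => Some (z' i))) ->
  misclustering theta z zh <= (1 + Gc) * (12 * (1 + eps) * F / (Delta * b0)).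
Proof.
move=> k0 eps0 F0 /andP[De0 De2] b00 Gc0 th0 QE bB w1 wsep err mass zh0 opt.
pose rho i := l1norm (row i Phat).
have rho0 i : 0 <= rho i by apply: l1norm_ge0.
pose pt := normalized_row Phat.
pose S0 := zero_rows Phat.
pose er i := l1norm (row i Phat - row i Q).
have er0 i : 0 <= er i by apply: l1norm_ge0.
have kR : 0 < (k%:R : R) by rewrite ltr0n.
have b0' u : 0 <= b u by apply: le_trans (bB u); apply: ltW.
pose inner (P : 'I_n -> bool) v := \sum_(i | P i) rho i * l1norm (pt i - v).
have inner0 P v : 0 <= inner P v.
  by apply: sumr_ge0 => i _; rewrite mulr_ge0 ?l1norm_ge0.
have costE (h : 'I_n -> option 'I_k) : kmedian_cost Phat h =
   \sum_u minval (inner (fun i => (i \notin S0) && (h i == Some u))) by [].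
have cost0 (h : 'I_n -> option 'I_k) : 0 <= kmedian_cost Phat h.
  rewrite costE; apply: sumr_ge0 => u _; apply: lb_le_inf.
    by exists (inner (fun i => (i \notin S0) && (h i == Some u)) 0); exists 0.
  by move=> _ [v _ <-]; apply: inner0.
have near i : i \notin S0 -> rho i * l1norm (pt i - w (z i)) <= 2 * er i.
  by move=> iS; apply: normalized_row_error (QE i) iS; rewrite ?w1 ?mulr_ge0.
have sumnear : \sum_(i | i \notin S0) rho i * l1norm (pt i - w (z i)) <= 2 * F.
  apply: (@le_trans _ _ (\sum_(i | i \notin S0) 2 * er i)).
    by apply: ler_sum => i; apply: near.
  rewrite -mulr_sumr ler_pM2l //; apply: le_trans err.
  rewrite [leRHS](bigID (fun i => i \notin S0)) /= lerDl.
  by apply: sumr_ge0 => i _; apply: l1norm_ge0.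
have costz : minval (fun z' : {ffun 'I_n -> 'I_k} =>
    kmedian_cost Phat (fun i => Some (z' i))) <= 2 * F.
  apply: le_trans (minval_le (finfun z) _) _; first by move=> y; apply: cost0.
  rewrite costE; apply: le_trans sumnear.
  rewrite (partition_big z xpredT) //=; apply: ler_sum => u _.
  apply: le_trans (minval_le (w u) (inner0 _)) _.
  rewrite /inner le_eqVlt; apply/orP; left; apply/eqP; apply: eq_big.
    by move=> i; rewrite ffunE.
  by move=> i /andP[_]; rewrite ffunE => /eqP[->].
have F0k : 0 < F / k%:R by rewrite divr_gt0.
(* centres whose cost is within [F] of the infimum in total *)
have /choice[v vP] : forall u, exists v,
    inner (fun i => (i \notin S0) && (zh i == Some u)) v <=
    minval (inner (fun i => (i \notin S0) && (zh i == Some u))) + F / k%:R.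
  by move=> u; apply: minval_approx => //; exact: 0.
(* the label itself outside [S0]; on [S0] the default makes [h] total *)
pose h i := odflt (z i) (zh i).
have hE i : i \notin S0 -> zh i = Some (h i).
  by rewrite -zh0 /h; case: (zh i).
have sumv : \sum_(i | i \notin S0) rho i * l1norm (pt i - v (h i)) <= 3 * (1 + eps) * F.
  rewrite (partition_big h xpredT) //=.
  apply: (@le_trans _ _ (kmedian_cost Phat zh + F)).
    have -> : F = \sum_(u < k) F / k%:R.
      by rewrite sumr_const card_ord -[RHS]mulr_natr divfK // gt_eqF.
    rewrite costE -big_split; apply: ler_sum => u _ /=; apply: le_trans (vP u).
    rewrite le_eqVlt; apply/orP; left; apply/eqP; apply: eq_big => i.
      by have [//|iS] := boolP (i \in S0); rewrite /= hE.
    by case/andP => _ /eqP ->.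
  have := ler_wpM2l (_ : 0 <= 1 + eps) costz; rewrite addr_ge0 // => /(_ isT) h1.
  have := mulr_ge0 eps0 (ltW F0); move: opt h1; lra.
have sumvw : \sum_(i | i \notin S0) rho i * l1norm (v (h i) - w (z i)) <= 5 * (1 + eps) * F.
  apply: (@le_trans _ _ (\sum_(i | i \notin S0) rho i * l1norm (pt i - v (h i)) +
    \sum_(i | i \notin S0) rho i * l1norm (pt i - w (z i)))).
    rewrite -big_split; apply: ler_sum => i _ /=; rewrite -mulrDr ler_wpM2l //.
    by rewrite [l1norm (pt i - v _)]l1norm_sub_swap; apply: l1norm_triangle.
  have := mulr_ge0 eps0 (ltW F0); move: sumv sumnear; lra.
pose Bad := [set i | (i \notin S0) && (Delta / 2 <= l1norm (v (h i) - w (z i)))]%SET.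
have BadE i : (i \in Bad) = (i \notin S0) && (Delta / 2 <= l1norm (v (h i) - w (z i))).
  by rewrite finset.in_set.
have sumBad : \sum_(i in Bad) rho i <= 10 * (1 + eps) * F / Delta.
  rewrite ler_pdivlMr //.
  suff : \sum_(i in Bad) rho i * (Delta / 2) <= 5 * (1 + eps) * F.
    by rewrite -mulr_suml; lra.
  apply: le_trans sumvw; rewrite big_mkcond [leRHS]big_mkcond; apply: ler_sum => i _.
  rewrite inE; case: ifP => [/andP[-> le]|_]; first by rewrite ler_wpM2l.
  by case: ifP => // _; rewrite mulr_ge0 ?l1norm_ge0.
pose Gd := (~: (Bad :|: S0))%SET.
have massbad : \sum_(i | i \notin Gd) theta 0 i <= 12 * (1 + eps) * F / (Delta * b0).
  rewrite invfM mulrA ler_pdivlMr // mulr_suml.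
  (* uses [Delta <= 2] *)
  have FD : F <= 2 * (1 + eps) * F / Delta.
    rewrite ler_pdivlMr //; apply: (@le_trans _ _ (F * 2)).
      by rewrite ler_pM2l.
    have := mulr_ge0 eps0 (ltW F0); lra.
  apply: (@le_trans _ _ (\sum_(i in Bad) rho i + \sum_i er i)); last first.
    move: sumBad err FD; rewrite /er; lra.
  rewrite big_mkcond [X in X + _]big_mkcond -big_split; apply: ler_sum => i _ /=.
  rewrite finset.in_setC negbK finset.in_setU.
  have thb : theta 0 i * b0 <= rho i + er i.
    apply: (@le_trans _ _ (l1norm (row i Q))).
      by rewrite QE l1normZ w1 mulr1 ger0_norm ?mulr_ge0 // ler_wpM2l.
    have := l1norm_triangle (row i Q) 0 (row i Phat); rewrite !subr0.
    by rewrite [l1norm (row i Q - _)]l1norm_sub_swap addrC.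
  have [iB|iB] /= := boolP (i \in Bad); first by [].
  rewrite add0r; case: ifP => // iS.
  by move: iS thb; rewrite inE -/(rho i) => /eqP ->; rewrite add0r.
have [||s [lost [split [cardle good notlost]]]] := @label_matching n k z zh Gd.
- by move=> i; rewrite finset.in_setC finset.in_setU negb_or => /andP[_]; rewrite zh0.
- move=> i j; rewrite !finset.in_setC !finset.in_setU !negb_or => /andP[iB iS] /andP[jB jS] zij.
  move: iB jB; rewrite !BadE iS jS /= -!ltNge => iB jB.
  apply/negP => /eqP; rewrite !hE // => -[hij].
  have := wsep _ _ zij; apply/negP; rewrite -ltNge.
  apply: le_lt_trans (l1norm_triangle _ _ (v (h i))) _.
  rewrite [l1norm (w (z i) - _)]l1norm_sub_swap {2}hij; lra.
apply: le_trans (minval_le s _) _; first by move=> t; apply: sumr_ge0.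
apply: (@le_trans _ _ (\sum_(i | i \notin Gd) theta 0 i +
   \sum_(u in split) \sum_(i | z i == u) theta 0 i)).
  have -> : \sum_(u in split) \sum_(i | z i == u) theta 0 i =
     \sum_(i | z i \in split) theta 0 i.
    rewrite [RHS](partition_big z (mem split)) //=; apply: eq_bigr => u us.
    by apply: eq_bigl => i; case: eqP => [->|]; rewrite ?us ?andbF.
  rewrite big_mkcond [X in _ <= X + _]big_mkcond [X in _ <= _ + X]big_mkcond -big_split.
  apply: ler_sum => i _ /=.
  have [iG|iG] := boolP (i \in Gd); have [is_|is_] := boolP (z i \in split);
    rewrite /= ?add0r ?addr0.
  + by case: ifP.
  + by rewrite (good i) // eqxx.
  + by case: ifP => // _; [rewrite lerDl | rewrite addr_ge0].
  + by case: ifP.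
rewrite mulrDl mul1r; apply: lerD => //.
apply: (@le_trans _ _ (Gc * \sum_(i | i \notin Gd) theta 0 i)); last by rewrite ler_wpM2l.
apply: (@le_trans _ _ (\sum_(u in split) Gc * g)).
  by apply: ler_sum => u _; case/andP: (mass u).
have g0 : 0 <= Gc * g.
  by case/andP: (mass (Ordinal k0)) => _; apply: le_trans; apply: sumr_ge0.
apply: (@le_trans _ _ (\sum_(u in lost) Gc * g)).
  by rewrite !sumr_const ler_wpMn2l.
rewrite -mulr_sumr ler_wpM2l //.
apply: (@le_trans _ _ (\sum_(u in lost) \sum_(i | z i == u) theta 0 i)).
  by apply: ler_sum => u _; case/andP: (mass u).
have -> : \sum_(u in lost) \sum_(i | z i == u) theta 0 i = \sum_(i | z i \in lost) theta 0 i.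
  rewrite [RHS](partition_big z (mem lost)) //=; apply: eq_bigr => u us.
  by apply: eq_bigl => i; case: eqP => [->|]; rewrite ?us ?andbF.
rewrite big_mkcond [leRHS]big_mkcond; apply: ler_sum => i _.
case: ifP => [il|_]; last by case: ifP.
have [iG|//] := boolP (i \in Gd).
by have := notlost i iG; rewrite il.
Qed.

(** * Geometry of the mean matrix *)

Lemma coord_le_norm (R : realType) n (x : 'rV[R]_n) i : `|x 0 i| <= `|x|.
Proof.
rewrite [leRHS]/Num.norm /= mx_normrE.
exact: (le_bigmax _ (fun ij : 'I_1 * 'I_n => `|x ij.1 ij.2|) (0, i)).
Qed.

Lemma norm_attained (R : realType) n (x : 'rV[R]_n) :
  0 < `|x| -> exists i, `|x| = `|x 0 i|.
Proof.
move=> x0; have : mx_norm x != 0 by rewrite -[mx_norm x]/(`|x|) gt_eqF.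
by case/mx_norm_neq0 => -[a i] /= xE; exists i; rewrite -[`|x|]/(mx_norm x) xE ord1.
Qed.

Definition cmass (R : realType) (n k : nat) (theta : 'rV[R]_n) (z : 'I_n -> 'I_k)
    (u : 'I_k) : R := \sum_(i | z i == u) theta 0 i.

Lemma csizeE (R : realType) n k (z : 'I_n -> 'I_k) u :
  (csize z u)%:R = \sum_(i | z i == u) (1 : R).
Proof. by rewrite sumr_const; congr (_ *+ _); apply: eq_card => i; rewrite !inE. Qed.

(** A vanishing [|theta| k / n] has three uses.  It makes [n / k] large, because
    averages near 1 force [|theta| >= 1 / 2]; so community sizes are of order [n / k].
    It makes a single vertex negligible in its community; and since the edge
    probabilities of the vertex of largest [theta] inside its community are at most 1,
    summing them gives [|theta| * p <= 4]. *)
Lemma dcbm_masses (R : realType) (n k : nat) (theta : 'rV[R]_n)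
    (p q beta delta : R) (P : 'M[R]_n) (z : 'I_n -> 'I_k) (B : 'M[R]_k) :
  (0 < n)%N -> (0 < k)%N -> 1 <= beta -> 0 < q -> (forall i, 0 <= theta 0 i) ->
  delta <= 1 / 2 -> `|theta| <= n%:R / k%:R / (8 * beta) ->
  dcbm_witness theta p q beta delta P z B ->
  [/\ forall u, n%:R / (4 * beta * k%:R) <= cmass theta z u <= 3 * beta * n%:R / k%:R,
      \sum_u cmass theta z u <= 3 / 2 * n%:R,
      `|theta| * p <= 4 & `|theta| <= n%:R].
Proof.
move=> n0 k0 be1 q0 th0 de tle [P01 [BT [PD [PE [avg [Bq [qp [Bp size]]]]]]]].
have be0 : 0 < beta by lra.
have nR : 0 < (n%:R : R) by rewrite ltr0n.
have kR : 0 < (k%:R : R) by rewrite ltr0n.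
set t := `|theta|; set x := n%:R / k%:R : R in tle.
have x0 : 0 < x by rewrite divr_gt0.
have tht i : theta 0 i <= t by rewrite -[leLHS]ger0_norm // coord_le_norm.
have cs0 u : 0 < (csize z u)%:R :> R.
  rewrite ltr0n lt0n; apply/eqP => c0; have := avg u.
  by rewrite c0 invr0 mulr0 => /andP[h _]; lra.
have massB u : (csize z u)%:R / 2 <= cmass theta z u <= 3 / 2 * (csize z u)%:R.
  have /andP[] := avg u; rewrite ler_pdivlMr // ler_pdivrMr // -/(cmass theta z u).
  move=> h1 h2; have h3 := ler_wpM2r (ltW (cs0 u)) de.
  by apply/andP; split; lra.
have masst u : cmass theta z u <= (csize z u)%:R * t.
  by rewrite (csizeE R) mulr_suml; apply: ler_sum => i _; rewrite mul1r.
pose u0 := Ordinal k0.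
have t2 : 1 / 2 <= t.
  rewrite -(ler_pM2l (cs0 u0)) mulrA mulr1; apply: le_trans (masst u0).
  by case/andP: (massB u0).
have x4 : 4 * beta <= x.
  move: tle; rewrite -/t ler_pdivlMr; last lra.
  have := ler_wpM2r (_ : 0 <= 8 * beta) t2; move/(_ ltac:(lra)); lra.
have sizeB u : x / (2 * beta) <= (csize z u)%:R <= 2 * beta * x.
  have /andP[] := size u.
  have -> : n%:R / (beta * k%:R) = x / beta by rewrite /x; field; rewrite !gt_eqF.
  have -> : beta * n%:R / k%:R = beta * x by rewrite /x mulrA.
  have -> : x / beta = x / (2 * beta) + x / (2 * beta) by field; rewrite !gt_eqF.
  have h : 1 <= x / (2 * beta) by rewrite ler_pdivlMr; lra.
  have h' : 1 <= beta * x by apply: mulr_ege1 => //; lra.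
  by move=> h1 h2; apply/andP; split; lra.
have massB' u : x / (4 * beta) <= cmass theta z u.
  have /andP[h1 _] := massB u; have /andP[h2 _] := sizeB u.
  have -> : x / (4 * beta) = x / (2 * beta) / 2 by field; rewrite gt_eqF.
  lra.
split.
- move=> u; have -> : n%:R / (4 * beta * k%:R) = x / (4 * beta).
    by rewrite /x; field; rewrite !gt_eqF.
  have -> : 3 * beta * n%:R / k%:R = 3 * beta * x by rewrite /x; ring.
  rewrite massB' /=; have /andP[_ h1] := massB u; have /andP[_ h2] := sizeB u.
  lra.
- apply: (@le_trans _ _ (\sum_u 3 / 2 * (csize z u)%:R)).
    by apply: ler_sum => u _; case/andP: (massB u).
  rewrite -mulr_sumr ler_wpM2l //.
  under eq_bigr => u _ do rewrite (csizeE R).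
  have <- : \sum_(i < n) (1 : R) = n%:R by rewrite sumr_const card_ord.
  by rewrite [leRHS](partition_big z xpredT).
- have t0 : 0 < t by lra.
  have [i ti] := norm_attained t0.
  rewrite -/t ger0_norm // in ti; set u := z i.
  (* [i] has the largest [theta]; its community without [i] still has a quarter of
     the size *)
  have rest : cmass theta z u - t = \sum_(j | (z j == u) && (j != i)) theta 0 j.
    by rewrite /cmass (bigD1 i) //= -ti; ring.
  have size' : \sum_(j | (z j == u) && (j != i)) t * p * theta 0 j <= (csize z u)%:R.
    rewrite (csizeE R) [leRHS](bigD1 i) //=; apply: (@le_trans _ _ (0 + \sum_(j | (z j == u) && (j != i)) 1)).
      rewrite add0r; apply: ler_sum => j /andP[/eqP zj ji].
      have /andP[_ P1] := P01 j i; apply: le_trans P1; rewrite PE // zj -/u.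
      have := ler_wpM2l (mulr_ge0 (th0 j) (th0 i)) (Bp u); rewrite -ti; lra.
    by rewrite lerD2r.
  have p0 : 0 < p by lra.
  rewrite -mulr_sumr -rest in size'.
  have c4 : (csize z u)%:R / 4 <= cmass theta z u - t.
    have /andP[h1 _] := massB u; have /andP[h2 _] := sizeB u.
    have : x / (8 * beta) = x / (2 * beta) / 4 by field; rewrite gt_eqF.
    move: tle; rewrite -/t; lra.
  have tp0 : 0 <= t * p by rewrite mulr_ge0 // ltW.
  have := le_trans (ler_wpM2l tp0 c4) size'.
  rewrite -[leRHS]mul1r mulrCA -ler_pdivlMl //.
  have -> : (csize z u)%:R^-1 * (1 * (csize z u)%:R) = 1 :> R by rewrite mul1r mulVf // gt_eqF.
  lra.
- apply: le_trans tle _; rewrite ler_pdivrMr; last lra.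
  have : x <= n%:R.
    by rewrite /x ler_pdivrMr // ler_peMr ?ler1n // ltW.
  have := ler_wpM2r (ltW nR) (_ : 1 <= 8 * beta); move/(_ ltac:(lra)); lra.
Qed.

Section Centers.
Variables (R : realType) (n k : nat) (theta : 'rV[R]_n) (z : 'I_n -> 'I_k) (B : 'M[R]_k).

(** The mean of the graph completed on the diagonal, so as to have rank at most
    [k]. *)
Definition expected : 'M[R]_n := \matrix_(i, j) (theta 0 i * theta 0 j * B (z i) (z j)).

Definition row_weight (u : 'I_k) : R := \sum_v B u v * cmass theta z v.

(** The common direction of the rows of [expected] in community [u], normalised to
    have l1 norm 1. *)
Definition center (u : 'I_k) : 'rV[R]_n :=
  \row_j (theta 0 j * B u (z j) / row_weight u).

Lemma expected_rank : (\rank expected <= k)%N.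
Proof.
pose M : 'M[R]_(n, k) := \matrix_(i, u) (if u == z i then theta 0 i else 0).
pose N : 'M[R]_(k, n) := \matrix_(u, j) (B u (z j) * theta 0 j).
have -> : expected = M *m N.
  apply/matrixP => i j; rewrite !mxE (bigD1 (z i)) //= big1 ?addr0.
    by rewrite !mxE eqxx; ring.
  by move=> u ui; rewrite mxE (negbTE ui) mul0r.
exact: mulmx_max_rank.
Qed.

Lemma row_expected i : row_weight (z i) != 0 ->
  row i expected = (theta 0 i * row_weight (z i)) *: center (z i).
Proof.
by move=> b0; apply/rowP => j; rewrite !mxE; field.
Qed.

Lemma sum_by_community (F : 'I_k -> R) :
  \sum_j theta 0 j * F (z j) = \sum_v F v * cmass theta z v.
Proof.
rewrite (partition_big z xpredT) //=; apply: eq_bigr => v _.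
by rewrite mulr_sumr; apply: eq_bigr => j /eqP ->; rewrite mulrC.
Qed.

Lemma l1norm_center u :
  (forall i, 0 <= theta 0 i) -> (forall v, 0 <= B u v) -> 0 < row_weight u ->
  l1norm (center u) = 1.
Proof.
move=> th0 B0 b0; rewrite /l1norm.
rewrite (eq_bigr (fun j => theta 0 j * B u (z j) / row_weight u)); last first.
  by move=> j _; rewrite mxE ger0_norm // divr_ge0 ?mulr_ge0 // ltW.
by rewrite -mulr_suml sum_by_community -/(row_weight u) divff // gt_eqF.
Qed.

(** As [v] has the smaller row weight, its centre exceeds that of [u] by at least
    [theta_j (p - q) / row_weight v] at each vertex [j] of community [v]. *)
Lemma center_gap u v (p q g bmax : R) :
  (forall i, 0 <= theta 0 i) -> 0 <= B u v <= q -> p <= B v v -> q < p -> 0 <= g ->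
  g <= cmass theta z v -> 0 < row_weight v <= row_weight u -> row_weight v <= bmax ->
  g * (p - q) / bmax <= l1norm (center u - center v).
Proof.
move=> th0 /andP[Buv0 Buv] Bvv qp g0 mass /andP[bv0 bvu] bmx.
have bu0 : 0 < row_weight u by apply: lt_le_trans bvu.
have bm0 : 0 < bmax by apply: lt_le_trans bmx.
apply: (@le_trans _ _ (cmass theta z v * ((p - q) / row_weight v))).
  rewrite -mulrA; apply: ler_pM => //; first by rewrite divr_ge0 ?ltW // subr_gt0.
  by rewrite ler_wpM2l ?lef_pV2 ?posrE // subr_ge0 ltW.
rewrite l1norm_sub_swap; apply: (@le_trans _ _ (\sum_(j | z j == v) `|(center v - center u) 0 j|)); last first.
  rewrite /l1norm [leRHS](bigID (fun j => z j == v)) /= lerDl.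
  by apply: sumr_ge0.
rewrite mulr_suml; apply: ler_sum => j /eqP zj.
apply: le_trans (ler_norm _); rewrite !mxE zj -[X in _ <= X - _]mulrA.
rewrite -[X in _ <= _ - X]mulrA -mulrBr ler_wpM2l //.
have h1 : p / row_weight v <= B v v / row_weight v by rewrite ler_pM2r // invr_gt0.
have h2 : B u v / row_weight u <= q / row_weight v.
  by apply: ler_pM; rewrite ?invr_ge0 ?(ltW bu0) // lef_pV2 ?posrE.
rewrite mulrBl; lra.
Qed.

End Centers.

(** * Recovery on the good event *)

Lemma op_const_gt0 (R : realType) (al C1 cd : R) :
  0 < al -> 0 < C1 -> 0 <= cd -> 0 < op_const al C1 cd.
Proof.
move=> al0 C10 cd0; have e0 : 0 < expR 2 * al by rewrite mulr_gt0 ?expR_gt0.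
have : 0 < al * (32 / C1) by rewrite mulr_gt0 // divr_gt0.
rewrite /op_const /core_const /heavy_const /dyadic_const -mulrA; lra.
Qed.

(** Each unordered pair is represented by its increasing orientation, which makes the
    entries of the array independent. *)
Definition upper_prob (R : realType) n (P : 'M[R]_n) (e : 'I_n * 'I_n) : R :=
  if (e.1 < e.2)%N then P e.1 e.2 else 0.

Definition error_const (R : realType) (alpha beta C1 : R) : R :=
  (1 + 12 * beta ^+ 2) * (1296 * alpha * beta ^+ 2 * op_const alpha C1 (2 * alpha)).

Section GoodEvent.
Variables (R : realType) (n k : nat) (theta : 'rV[R]_n) (p q beta delta alpha : R).
Variables (P : 'M[R]_n) (z : 'I_n -> 'I_k) (B : 'M[R]_k).
Hypotheses (n0 : (0 < n)%N) (k0 : (0 < k)%N) (be1 : 1 <= beta) (al1 : 1 <= alpha).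
Hypotheses (q0 : 0 < q) (th0 : forall i, 0 <= theta 0 i) (de : delta <= 1 / 2).
Hypothesis tle : `|theta| <= n%:R / k%:R / (8 * beta).
Hypothesis wit : dcbm_witness theta p q beta delta P z B.
Hypothesis Bal : forall u, B u u <= alpha * p.

Let sd : R := Num.sqrt (n%:R * `|theta| ^+ 2 * p + 1).
Let rho : R := alpha * sd ^+ 2 / n%:R.
Let masses := dcbm_masses n0 k0 be1 q0 th0 de tle wit.

Let p0 : 0 < p.
Proof. by case: wit => _ [_ [_ [_ [_ [_ [qp _]]]]]]; apply: lt_trans q0 qp. Qed.

Let nR : 0 < (n%:R : R). Proof. by rewrite ltr0n. Qed.
Let kR : 0 < (k%:R : R). Proof. by rewrite ltr0n. Qed.
Let be0 : 0 < beta. Proof. exact: lt_le_trans be1. Qed.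
Let al0 : 0 < alpha. Proof. exact: lt_le_trans al1. Qed.

(** [sd] is the square root of a bound, up to the factor [alpha], on the expected
    degrees, increased by 1. *)
Lemma mean_degree_sqr : sd ^+ 2 = n%:R * p * `|theta| ^+ 2 + 1.
Proof.
rewrite sqr_sqrtr; first by ring.
by rewrite addr_ge0 // !mulr_ge0 ?sqr_ge0 // ltW.
Qed.

Lemma mean_degree_gt0 : 0 < sd.
Proof.
by rewrite sqrtr_gt0 ltr_wpDl // !mulr_ge0 ?sqr_ge0 // ltW.
Qed.

(** Off the diagonal [B] is nonnegative because it is proportional to probabilities,
    each community containing a vertex of positive [theta]. *)
Lemma connectivity_bounds u v : 0 <= B u v <= alpha * p.
Proof.
case: wit => [P01 [_ [_ [PE [_ [Bq [qp [Bp _]]]]]]]].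
have [mass _ _ _] := masses.
have [->|uv] := eqVneq u v.
  by rewrite Bal andbT; apply: le_trans (Bp v); rewrite ltW.
have ex w : exists2 i, z i = w & 0 < theta 0 i.
  have /andP[m0 _] := mass w.
  apply: contrapT => nex; move: m0; apply/negP; rewrite -ltNge.
  rewrite /cmass big1; first by rewrite divr_gt0 // !mulr_gt0.
  move=> i /eqP zi; apply/eqP; rewrite eq_le th0 andbT leNgt; apply/negP => ti.
  by apply: nex; exists i.
have [i zi ti] := ex u; have [j zj tj] := ex v.
have ij : i != j by apply: contraNneq uv => ij; rewrite -zi -zj ij.
apply/andP; split; last first.
  apply: le_trans (Bq _ _ uv) _; apply: le_trans (ltW qp) _.
  by rewrite ler_peMl // ltW.
by have /andP[h _] := P01 i j; move: h; rewrite PE // zi zj pmulr_rge0 // mulr_gt0.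
Qed.

Lemma entry_bound i j : theta 0 i * theta 0 j * B (z i) (z j) <= rho.
Proof.
have /andP[B0 B1] := connectivity_bounds (z i) (z j).
have tht l : theta 0 l <= `|theta| by rewrite -[leLHS]ger0_norm // coord_le_norm.
apply: (@le_trans _ _ (`|theta| * `|theta| * (alpha * p))).
  by apply: ler_pM => //; [rewrite mulr_ge0 | apply: ler_pM].
rewrite /rho mean_degree_sqr ler_pdivlMr //.
have -> : `|theta| * `|theta| * (alpha * p) * n%:R =
  alpha * (n%:R * p * `|theta| ^+ 2) by ring.
by rewrite ler_pM2l // lerDl.
Qed.

Lemma expected_offdiag i j : i != j -> expected theta z B i j = P i j.
Proof. by case: wit => [_ [_ [_ [PE _]]]] ij; rewrite mxE PE. Qed.

Lemma upper_prob_bounds e : 0 <= upper_prob P e <= rho.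
Proof.
have rho0 : 0 <= rho.
  by apply: divr_ge0 => //; apply: mulr_ge0; [exact: ltW | exact: sqr_ge0].
rewrite /upper_prob; case: ifP => [lt|_]; last by rewrite lexx.
have [P01 _] := wit; have /andP[-> _] /= := P01 e.1 e.2.
have ne : e.1 != e.2 by rewrite -val_eqE neq_ltn lt.
by rewrite -expected_offdiag // mxE entry_bound.
Qed.

Lemma expected_upper_prob i j : i != j ->
  expected theta z B i j = upper_prob P (i, j) + upper_prob P (j, i).
Proof.
move=> ij; case: (wit) => [_ [BT [_ [PE _]]]]; rewrite /upper_prob /=.
have PT : P j i = P i j.
  by rewrite !PE // 1?eq_sym // -{1}BT mxE [theta 0 j * _]mulrC.
rewrite expected_offdiag //; case: (ltngtP i j) => [_|_|/val_inj e].
- by rewrite addr0.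
- by rewrite add0r PT.
- by rewrite e eqxx in ij.
Qed.

(** The completed diagonal can exceed 1, but from [|theta| p <= 4] and
    [|theta| <= n] it follows that [(|theta|^2 p)^2 <= 4 n |theta|^2 p <= 4 sd^2]. *)
Lemma expected_diag i : `|expected theta z B i i| <= 2 * alpha * sd.
Proof.
have [_ _ tp tn] := masses.
have /andP[B0 B1] := connectivity_bounds (z i) (z i).
have thi : theta 0 i <= `|theta| by rewrite -[leLHS]ger0_norm // coord_le_norm.
rewrite mxE ger0_norm; last by rewrite !mulr_ge0.
set t := `|theta| in tp tn thi *.
have t0 : 0 <= t by apply: normr_ge0.
have t2p0 : 0 <= t ^+ 2 * p by rewrite mulr_ge0 ?sqr_ge0 // ltW.
have h : t ^+ 2 * p <= 2 * sd.
  have sd0 := mean_degree_gt0.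
  have h1 : (t ^+ 2 * p) ^+ 2 <= (2 * sd) ^+ 2.
    have -> : (2 * sd) ^+ 2 = 4 * sd ^+ 2 by ring.
    rewrite mean_degree_sqr -/t.
    have a1 : t * (t * p) <= n%:R * 4 by apply: ler_pM => //; rewrite mulr_ge0 // ltW.
    have := ler_wpM2l t2p0 a1; lra.
  by rewrite -(@ler_pXn2r _ 2%N) // nnegrE // mulr_ge0 // ltW.
apply: (@le_trans _ _ (t * t * (alpha * p))).
  by apply: ler_pM => //; [rewrite mulr_ge0 | apply: ler_pM].
have := ler_wpM2l (ltW al0) h; lra.
Qed.

Lemma row_weight_bounds u :
  p * (n%:R / (4 * beta * k%:R)) <= row_weight theta z B u <= 3 / 2 * alpha * p * n%:R.
Proof.
case: wit => [_ [_ [_ [_ [_ [_ [_ [Bp _]]]]]]]]; have [mass tot _ _] := masses.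
have m0 v : 0 <= cmass theta z v by apply: sumr_ge0.
apply/andP; split.
  rewrite /row_weight (bigD1 u) //=.
  apply: (@le_trans _ _ (B u u * cmass theta z u)).
    apply: ler_pM => //; [exact: ltW | | by case/andP: (mass u)].
    by rewrite divr_ge0 // ?mulr_ge0 // ltW.
  rewrite lerDl; apply: sumr_ge0 => v _; rewrite mulr_ge0 //.
  by case/andP: (connectivity_bounds u v).
apply: (@le_trans _ _ (alpha * p * \sum_v cmass theta z v)).
  rewrite mulr_sumr; apply: ler_sum => v _; rewrite ler_wpM2r //.
  by case/andP: (connectivity_bounds u v).
have := ler_wpM2l (mulr_ge0 (ltW al0) (ltW p0)) tot; lra.
Qed.

Lemma centers_separated u v : u != v ->
  (p - q) / (6 * alpha * beta * k%:R * p) <=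
    l1norm (center theta z B u - center theta z B v).
Proof.
move=> uv; case: wit => [_ [_ [_ [_ [_ [Bq [qp [Bp _]]]]]]]]; have [mass _ _ _] := masses.
have g0 : 0 < n%:R / (4 * beta * k%:R) :> R by rewrite divr_gt0 // !mulr_gt0.
have rw0 x : 0 < row_weight theta z B x.
  by have /andP[h _] := row_weight_bounds x; apply: lt_le_trans h; rewrite mulr_gt0.
have -> : (p - q) / (6 * alpha * beta * k%:R * p) =
    n%:R / (4 * beta * k%:R) * (p - q) / (3 / 2 * alpha * p * n%:R).
  by field; rewrite !gt_eqF.
have gap x y : x != y -> row_weight theta z B y <= row_weight theta z B x ->
    n%:R / (4 * beta * k%:R) * (p - q) / (3 / 2 * alpha * p * n%:R) <=
    l1norm (center theta z B x - center theta z B y).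
  move=> xy le; apply: center_gap => //.
  - by rewrite Bq // andbT; case/andP: (connectivity_bounds x y).
  - exact: ltW.
  - by case/andP: (mass y).
  - by rewrite rw0.
  - by case/andP: (row_weight_bounds y).
have [le|/ltW le] := leP (row_weight theta z B v) (row_weight theta z B u).
  exact: gap.
by rewrite l1norm_sub_swap; apply: gap => //; rewrite eq_sym.
Qed.

(** The deterministic core: on the event that the light sums and the discrepancies
    are controlled, every output of the algorithm recovers the communities. *)
Lemma good_event_recovery (C1 eps : R) (f : {ffun 'I_n * 'I_n -> bool}) (A : 'M[R]_n)
    (zh : 'I_n -> option 'I_k) :
  2 * expR 2 * alpha < C1 -> 0 <= eps ->
  light_ok (upper_prob P) sd (32 * alpha + 16) f -> disc_ok rho f ->
  (forall i j, A i j = (f (i, j))%:R + (f (j, i))%:R) ->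
  alg1_output A (C1 * (n%:R * p * `|theta| ^+ 2 + 1)) eps zh ->
  misclustering theta z zh <= error_const alpha beta C1 *
    ((1 + eps) * k%:R `^ (5 / 2) * sd / (p - q)).
Proof.
move=> C1al eps0 light disc AE [Phat [minP zh0 opt]].
have qp : q < p by case: wit => [_ [_ [_ [_ [_ [_ [qp _]]]]]]].
have pq0 : 0 < p - q by rewrite subr_gt0.
have sd0 := mean_degree_gt0.
have C10 : 0 < C1 by apply: lt_trans C1al; rewrite !mulr_gt0 ?expR_gt0.
rewrite -mean_degree_sqr in minP.
have al20 : 0 <= 2 * alpha by rewrite mulr_ge0 // ltW.
pose K := op_const alpha C1 (2 * alpha) * sd.
have op0 := op_const_gt0 al0 C10 al20.
have K0 : 0 < K by rewrite mulr_gt0.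
pose Q := expected theta z B.
have spec x y : \sum_i x i ^+ 2 <= 1 -> \sum_i y i ^+ 2 <= 1 ->
    \sum_i \sum_j x i * y j * (trim (C1 * sd ^+ 2) A i j - Q i j) <= K.
  apply: (trimmed_spectral_bound (pr := upper_prob P) (f := f)) => //.
  - exact: upper_prob_bounds.
  - by move=> i; rewrite /upper_prob ltnn.
  - exact: expected_upper_prob.
  - by move=> i j _; rewrite mxE entry_bound.
  - exact: expected_diag.
have frob := low_rank_denoising minP (expected_rank theta z B) (ltW K0) spec.
pose F := 9 / 2 * n%:R * Num.sqrt k%:R * K.
have F0 : 0 < F by rewrite !mulr_gt0 // ?sqrtr_gt0.
have err : \sum_i l1norm (row i Phat - row i Q) <= F.
  have := @l1_error R n k (Phat - Q) K n0 k0 K0.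
  under eq_bigr => i _ do under eq_bigr => j _ do rewrite mxE [(- Q) i j]mxE.
  move/(_ frob); apply: le_trans; rewrite le_eqVlt; apply/orP; left; apply/eqP.
  by apply: eq_bigr => i _; apply: eq_bigr => j _; rewrite !mxE.
have [mass _ _ _] := masses.
have g0 : 0 < n%:R / (4 * beta * k%:R) :> R by rewrite divr_gt0 // !mulr_gt0.
have De0 : 0 < (p - q) / (6 * alpha * beta * k%:R * p).
  by rewrite divr_gt0 // !mulr_gt0.
have rec := @kmedian_recovery R n k theta z zh Phat Q (center theta z B)
  (row_weight theta z B) eps F ((p - q) / (6 * alpha * beta * k%:R * p))
  (p * (n%:R / (4 * beta * k%:R))) (n%:R / (4 * beta * k%:R)) (12 * beta ^+ 2)
  k0 eps0 F0.
apply: le_trans (rec _ _ _ th0 _ _ _ _ err _ zh0 opt) _.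
- rewrite De0 /= ler_pdivrMr ?mulr_gt0 //.
  have h1 : 1 <= alpha * beta by apply: mulr_ege1.
  have h2 : 1 <= alpha * beta * k%:R by apply: mulr_ege1 => //; rewrite ler1n.
  by have := ler_wpM2r (ltW p0) h2; move: q0 p0; lra.
- by rewrite mulr_gt0.
- by rewrite mulr_ge0 ?sqr_ge0.
- move=> i; apply: row_expected; rewrite gt_eqF //.
  by have /andP[h _] := row_weight_bounds (z i); apply: lt_le_trans h; rewrite mulr_gt0.
- by move=> u; case/andP: (row_weight_bounds u).
- move=> u; apply: l1norm_center => //.
    by move=> v; case/andP: (connectivity_bounds u v).
  by have /andP[h _] := row_weight_bounds u; apply: lt_le_trans h; rewrite mulr_gt0.
- exact: centers_separated.
- move=> u; have -> : 12 * beta ^+ 2 * (n%:R / (4 * beta * k%:R)) = 3 * beta * n%:R / k%:R.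
    by field; rewrite !gt_eqF.
  exact: mass.
have -> : k%:R `^ (5 / 2) = k%:R ^+ 2 * Num.sqrt k%:R :> R.
  have -> : 5 / 2 = 2%:R + 2^-1 :> R by lra.
  rewrite powRD; last by rewrite (gt_eqF kR) implybT.
  by rewrite powR_mulrn // powR12_sqrt.
rewrite le_eqVlt; apply/orP; left; apply/eqP.
rewrite /error_const /F /K; field.
by rewrite !gt_eqF.
Qed.

End GoodEvent.

Lemma upper_prob_le1 (R : realType) n (P : 'M[R]_n) e :
  (forall i j, 0 <= P i j <= 1) -> 0 <= upper_prob P e <= 1.
Proof. by move=> P01; rewrite /upper_prob; case: ifP => // _; rewrite lexx ler01. Qed.

(** Each of the two properties fails with probability at most [n ^- 4]. *)
Lemma failure_probability (R : realType) n (pr : 'I_n * 'I_n -> R) (al sd : R) :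
  (1 < n)%N -> 0 < al -> 0 < sd -> (forall e, 0 <= pr e <= 1) ->
  (forall e, 0 <= pr e <= al * sd ^+ 2 / n%:R) ->
  bern_prob pr (fun f => ~~ (light_ok pr sd (32 * al + 16) f &&
                             disc_ok (al * sd ^+ 2 / n%:R) f)) <= n%:R ^- 2.
Proof.
move=> n1 al0 sd0 pr01 prB; have n0 : (0 < n)%N by apply: ltnW.
have nR : 0 < (n%:R : R) by rewrite ltr0n.
have prle e : pr e <= al * sd ^+ 2 / n%:R by case/andP: (prB e).
have rho0 : 0 < al * sd ^+ 2 / n%:R by rewrite divr_gt0 // mulr_gt0 // exprn_gt0.
apply: (@le_trans _ _ (bern_prob pr (fun f => ~~ light_ok pr sd (32 * al + 16) f ||
   ~~ disc_ok (al * sd ^+ 2 / n%:R) f))).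
  by apply: bern_prob_le => // f; rewrite negb_and.
apply: le_trans (bern_prob_or _ _ pr01) _.
apply: (@le_trans _ _ (n%:R ^- 4 + n%:R ^- 4)).
  apply: lerD; last exact: disc_fail.
  apply: le_trans (light_fail n0 (ltW al0) sd0 pr01 prle) _.
  rewrite expRN expRM_natl lef_pV2 ?posrE ?exprn_gt0 ?expR_gt0 //.
  apply: lerXn2r; rewrite ?nnegrE ?expR_ge0 //.
  by have := expR_ge1Dx (n%:R : R); lra.
have -> : n%:R ^- 4 + n%:R ^- 4 = n%:R ^- 2 * (2 / n%:R ^+ 2) :> R.
  by field; rewrite gt_eqF.
rewrite ler_piMr ?invr_ge0 ?exprn_ge0 // ler_pdivrMr ?exprn_gt0 // mul1r.
rewrite -natrX ler_nat; apply: (@leq_trans (2 ^ 2)) => //.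
by rewrite leq_sqr.
Qed.

(** * From the good event to the probability bound *)

Lemma powR_opp2 (R : realType) n : n%:R `^ (- (1 + 1)) = n%:R ^- 2 :> R.
Proof. by rewrite powRN -[1 + 1]/(2%:R) powR_mulrn. Qed.

Lemma error_const_gt0 (R : realType) (alpha beta C1 : R) :
  0 < alpha -> 0 < beta -> 0 < C1 -> 0 < error_const alpha beta C1.
Proof.
move=> al0 be0 C10; have op0 : 0 < op_const alpha C1 (2 * alpha).
  by apply: op_const_gt0 => //; rewrite mulr_ge0 // ltW.
have b2 : 0 < beta ^+ 2 by apply: exprn_gt0.
apply: mulr_gt0; first by lra.
have num0 : 0 < 1296 :> R by lra.
exact: mulr_gt0 (mulr_gt0 (mulr_gt0 num0 al0) b2) op0.
Qed.

Theorem lemma1 (R : realType) (alpha beta M : R)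
    (halpha : 1 <= alpha) (hbeta : 1 <= beta) :
  exists2 C10 : R, 0 < C10 & forall C1 : R, C10 <= C1 ->
  exists C' C : R, [/\ 0 < C', 0 < C &
  forall (theta : forall n, 'rV[R]_n) (p q delta : nat -> R) (k : nat -> nat),
    (forall n, (2 <= k n)%N) ->
    (forall n i, 0 <= theta n 0 i) ->
    delta n @[n --> \oo] --> (0 : R) ->
    (\forall n \near \oo, 0 < q n /\ 1 < p n / q n <= M) ->
    `|theta n| / (n%:R / (k n)%:R) @[n --> \oo] --> (0 : R) ->
  \forall n \near \oo,
  forall (eps : R) (P : 'M[R]_n) (z : 'I_n -> 'I_(k n)),
    0 <= eps ->
    dcbm' (theta n) (p n) (q n) beta (delta n) alpha P z ->
  forall (d : measure_display) (T : measurableType d) (Pr : probability T R)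
      (A : 'I_n * 'I_n -> {RV Pr >-> bool})
      (zh : T -> {ffun 'I_n -> option 'I_(k n)}),
    dcbm_sample P A ->
    (forall f, measurable (zh @^-1` [set f])) ->
    (forall w, alg1_output (adjacency A w)
       (C1 * (n%:R * p n * `|theta n| ^+ 2 + 1)) eps (zh w)) ->
    ((1 - n%:R `^ (- (1 + C')))%R%:E <=
     Pr [set w | (misclustering (theta n) z (zh w) <=
           C * ((1 + eps) * (k n)%:R `^ (5 / 2) *
                Num.sqrt (n%:R * `|theta n| ^+ 2 * p n + 1)
                / (p n - q n)))%R])%E].
Proof.
have al0 : 0 < alpha by lra.
have be0 : 0 < beta by lra.
(* anything above [2 expR 2 alpha] makes degrees over half of the threshold exceed
   their mean by the factor that the discrepancy alternative requires *)
exists (3 * expR 2 * alpha); first by rewrite !mulr_gt0 ?expR_gt0.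
move=> C1 C1le.
have C1al : 2 * expR 2 * alpha < C1.
  apply: lt_le_trans C1le; rewrite ltr_pM2r // ltr_pM2r ?expR_gt0 //; lra.
have C10 : 0 < C1 by apply: lt_trans C1al; rewrite !mulr_gt0 ?expR_gt0.
exists 1, (error_const alpha beta C1); split => //.
  exact: error_const_gt0.
move=> theta p q delta k k2 th0 delta0 pq theta0.
have c0 : 0 < 1 / (8 * beta) by rewrite divr_gt0 // mulr_gt0.
near=> n => eps P z eps0 [B [wit Bal]] d T Pr A zh sample mzh alg.
have n1 : (1 < n)%N by near: n; exact: nbhs_infty_ge.
have n0 : (0 < n)%N by apply: ltnW.
have k0 : (0 < k n)%N by apply: leq_trans (k2 n).
have nR : 0 < (n%:R : R) by rewrite ltr0n.
have kR : 0 < ((k n)%:R : R) by rewrite ltr0n.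
have q0 : 0 < q n.
  by have [] : 0 < q n /\ 1 < p n / q n <= M by near: n.
have de : delta n <= 1 / 2.
  apply: le_trans (ler_norm _) _; apply: ltW.
  near: n; move/cvgrPdist_lt: delta0 => /(_ (1 / 2) ltac:(lra)).
  by apply: filterS => m; rewrite sub0r normrN.
have tle : `|theta n| <= n%:R / (k n)%:R / (8 * beta).
  have h : `|theta n| / (n%:R / (k n)%:R) < 1 / (8 * beta).
    apply: le_lt_trans (ler_norm _) _.
    near: n; move/cvgrPdist_lt: theta0 => /(_ _ c0).
    by apply: filterS => m; rewrite sub0r normrN.
  by move: h; rewrite ltr_pdivrMr ?divr_gt0 // mulrC mul1r => /ltW.
have p0 : 0 < p n.
  by case: (wit) => _ [_ [_ [_ [_ [_ [qp _]]]]]]; apply: lt_trans q0 qp.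
case: sample => Adiag Asym Alaw Aind.
pose sd : R := Num.sqrt (n%:R * `|theta n| ^+ 2 * p n + 1).
have sd0 : 0 < sd by rewrite sqrtr_gt0 ltr_wpDl // !mulr_ge0 ?sqr_ge0 // ltW.
have P01 : forall i j, 0 <= P i j <= 1 by case: wit.
pose D := [set e : 'I_n * 'I_n | (e.1 < e.2)%N]%SET.
pose conf w : {ffun 'I_n * 'I_n -> bool} := [ffun e => (e \in D) && A e w].
pose good f := light_ok (upper_prob P) sd (32 * alpha + 16) f &&
   disc_ok (alpha * sd ^+ 2 / n%:R) f.
have pr01 e : 0 <= upper_prob P e <= 1 by exact: upper_prob_le1.
have prB := upper_prob_bounds n0 k0 hbeta halpha q0 (th0 n) de tle wit Bal.
have [mbad Pbad] : measurable [set w | ~~ good (conf w)] /\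
    Pr [set w | ~~ good (conf w)] = (bern_prob (upper_prob P) (fun f => ~~ good f))%:E.
  apply: bern_prob_law => //.
    move=> -[i j]; rewrite inE /= => ij; rewrite /upper_prob /= ij; exact: Alaw.
  by move=> e; rewrite inE /upper_prob => /negbTE ->.
have fail := failure_probability n1 al0 sd0 pr01 prB.
set bound := error_const alpha beta C1 * _.
(* the target depends on the output [zh w] only, which takes finitely many values *)
have mtarget : measurable [set w | misclustering (theta n) z (zh w) <= bound].
  have -> : [set w | misclustering (theta n) z (zh w) <= bound] =
     \bigcup_(f in [set f : {ffun 'I_n -> option 'I_(k n)} |
        misclustering (theta n) z f <= bound]) (zh @^-1` [set f]).
    apply/seteqP; split => w /=; first by move=> h; exists (zh w).
    by case=> f /= h ->.
  by apply: fin_bigcup_measurable => // f _; apply: mzh.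
apply: (@le_trans _ _ (Pr (~` [set w | ~~ good (conf w)]))).
  rewrite probability_setC // Pbad -EFinB lee_fin lerD2l lerN2.
  by rewrite powR_opp2.
apply: le_measure; rewrite ?inE //; first exact: measurableC.
move=> w /= /negP; rewrite negbK => /andP[light disc].
apply: (good_event_recovery n0 k0 hbeta halpha q0 (th0 n) de tle wit Bal C1al eps0
  light disc _ (alg w)) => i j.
rewrite mxE !ffunE !inE /=.
case: (ltngtP i j) => [_|_|/val_inj ->] /=.
- by rewrite addr0.
- by rewrite add0r Asym.
- by rewrite Adiag addr0.
Unshelve. all: by end_near.
Qed.
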